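(* Let $F\le F'\le \mathrm{Sym}(\Omega)$, suppose $g\in G(F,F')$ is hyperbolic, and let $\mathcal{P}$ be a pando for $g$ with initial segment $\mathcal{P}_0$. Then $$s(g)=\frac{[U_{g(\mathcal{P})}:U_{\mathcal{P}\cup g(\mathcal{P})}]}{|M_{g,\mathcal{P}_0}|},$$ where $s$ is the scale function on $G(F,F')$.
   Context: $\mathbb{N}=\{1,2,\dots\}$, $\mathbb{N}_0=\mathbb{N}\cup\{0\}$. **Tree and groups.** $T$ is a locally finite regular (undirected, simple) tree with vertex set $V(T)$, edge set $E(T)\subset V(T)\times V(T)$ (each edge occurs as $(u,v)$ and as $(v,u)=\overline{(u,v)}$); $E(v)$ is the set of edges with origin $v$; $d$ is the path metric on vertices. $\Omega=\{0,\dots,\deg(T)-1\}$. Fix a legal colouring $c:E(T)\to\Omega$, i.e. $c(e)=c(\bar e)$ for all $e$ and $c|_{E(v)}:E(v)\to\Omega$ is a bijection for each $v$. For $g\in\mathrm{Aut}(T)$, $v\in V(T)$, the local action is $\sigma(g,v)=c\circ g\circ (c|_{E(v)})^{-1}\in\mathrm{Sym}(\Omega)$. For $F\le\mathrm{Sym}(\Omega)$, $U(F)=\{g\in\mathrm{Aut}(T):\sigma(g,v)\in F\ \forall v\in V(T)\}$ with the permutation topology. For $F\le F'\le\mathrm{Sym}(\Omega)$, $G(F,F')=\{g\in U(F'):\sigma(g,v)\in F\text{ for all but finitely many }v\}$, with the unique group topology making the inclusion $U(F)\to G(F,F')$ continuous and open; it is a totally disconnected locally compact (t.d.l.c.) group.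 The singularity set is $S(g)=\{v\in V(T):\sigma(g,v)\notin F\}$. For a set of vertices (or subtree) $V$, $U_V$ denotes the pointwise stabiliser of $V$ in $U(F)$. **Hyperbolic elements.** $g\in\mathrm{Aut}(T)$ is elliptic if it preserves some non-empty finite set of vertices, otherwise hyperbolic. If $g$ is hyperbolic, $\mathrm{axis}(g)$ is the bi-infinite path along which $g$ translates, and $\pi_g(v)$ is the vertex of $\mathrm{axis}(g)$ closest to $v\in V(T)$. **Scale.** For a t.d.l.c. group $G$ and $g\in G$, $s(g)=\min\{[gUg^{-1}:gUg^{-1}\cap U]: U\le G\text{ compact open}\}$. **Pandos.** A subtree $\mathcal{T}$ of $T$ is complete if every vertex $v$ of $\mathcal{T}$ either has all its $T$-neighbours in $\mathcal{T}$ or has valency $1$ in $\mathcal{T}$; $\mathrm{Int}(\mathcal{T})$ is the set of internal vertices, i.e. those $v\in V(\mathcal T)$ with $E(v)\subset E(\mathcal{T})$. A pando for a hyperbolic $g\in G(F,F')$ is a finite complete subtree $\mathcal{P}$ of $T$ such that: (P1) $S(g)\subset\mathrm{Int}(\mathcal{P})$; (P2) there is a vertex $v\in\mathrm{axis}(g)\cap\mathcal{P}$ with $g(v)\in\mathrm{Int}(\mathcal{P})$; (P3) if $v\in V(T)$ satisfies $\pi_g(v)\in\mathrm{Int}(\mathcal{P})$ and $d(u,\pi_g(u))=d(v,\pi_g(v))$ for some $u\in V(\mathcal{P})$, then $v\in V(\mathcal{P})$. The initial segment $\mathcal{P}_0$ is the smallest complete subtree of $T$ containing $\mathcal{P}\setminus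 g(\mathcal{P})$ (set difference of the sets of vertices and edges). **The set $M_{g,\mathcal{P}_0}$.** For $a\in\mathrm{Aut}(\mathcal{P}_0)$ and $v\in\mathrm{Int}(\mathcal{P}_0)$, $\sigma(a,v)\in\mathrm{Sym}(\Omega)$ is defined by $\sigma(a,v)=c\circ a\circ (c|_{E(v)})^{-1}$, using the colouring induced on $E(\mathcal{P}_0)$ by $c$. $M_{g,\mathcal{P}_0}$ is the set of $a\in\mathrm{Aut}(\mathcal{P}_0)$ such that (i) $a$ fixes $\mathrm{axis}(g)\cap\mathcal{P}_0$ pointwise, and (ii) for sufficiently large $k\in\mathbb{N}$, $\sigma(a,v)\in\sigma(g^k,a(v))^{-1}F\sigma(g^k,v)\cap F$ for all $v\in\mathrm{Int}(\mathcal{P}_0)$. *)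

(* Defs.v *)
From HB Require Import structures.
From mathcomp Require Import all_boot all_order all_algebra all_fingroup.
From mathcomp Require Import finmap.
From mathcomp Require Import all_classical.
From mathcomp Require Import topology.

Set Implicit Arguments.
Unset Strict Implicit.
Unset Printing Implicit Defensive.

Local Open Scope classical_set_scope.

(* 0 if A is infinite *)
Definition card_set (X : choiceType) (A : set X) : nat := #|` fset_set A|.

(* 0 if A is empty *)
Definition min_nat (A : set nat) : nat :=
  xget 0%N [set n | A n /\ forall m, A m -> (n <= m)%N].

Lemma min_natP (A : set nat) : A !=set0 ->
  A (min_nat A) /\ forall m, A m -> (min_nat A <= m)%N.
Proof.
move=> [n An]; rewrite /min_nat; case: xgetP => [m _ //|noM]; exfalso.
have exA : exists n, `[< A n >] by exists n; apply/asboolP.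
case: (ex_minnP exA) => m /asboolP Am mP; apply: (noM m); split=> // k Ak.
exact/mP/asboolP.
Qed.

Section GroupNotions.
Local Open Scope group_scope.
Variable G : groupType.
Implicit Types (g : G) (A B U : set G).

Definition subgroup U := U 1 /\ forall x y, U x -> U y -> U (x * y^-1).

Definition conj_set g U : set G := [set g * u * g^-1 | u in U].

Definition left_cosets A B : set (set G) := [set [set a * b | b in B] | a in A].

Definition group_index A B : nat := card_set (left_cosets A B).

End GroupNotions.

HB.mixin Record isTopologicalGroup G of monoid.Group G & Topological G := {
  mulg_continuous : continuous (fun x : G * G => (x.1 * x.2)%g) ;
  invg_continuous : continuous (fun x : G => (x^-1)%g)
}.

#[short(type="topGroupType")]
HB.structure Definition TopologicalGroup :=
  {G of monoid.Group G & Topological G & isTopologicalGroup G}.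

Definition compact_open_subgroup (G : topGroupType) (U : set G) :=
  [/\ subgroup U, compact U & open U].

Definition scale (G : topGroupType) (g : G) : nat :=
  min_nat [set group_index (conj_set g U) (conj_set g U `&` U)
            | U in @compact_open_subgroup G].

(* The indices entering [scale] are finite. *)
Section FiniteIndex.
Local Open Scope group_scope.
Variable G : topGroupType.

Lemma mull_continuous (a : G) : continuous (fun x : G => a * x).
Proof.
move=> x; apply: (@continuous2_cvg _ _ _ _ _ _ (fun=> a) id
  (fun u v : G => u * v) a x); first exact: (@mulg_continuous G (a, x)).
- exact: cvg_cst.
- exact: cvg_id.
Qed.

Lemma mulr_continuous (a : G) : continuous (fun x : G => x * a).
Proof.
move=> x; apply: (@continuous2_cvg _ _ _ _ _ _ id (fun=> a)
  (fun u v : G => u * v) x a); first exact: (@mulg_continuous G (x, a)).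
- exact: cvg_id.
- exact: cvg_cst.
Qed.

Lemma finite_left_cosets (A B : set G) : compact A -> open B -> subgroup B ->
  finite_set (left_cosets A B).
Proof.
move=> cA oB [B1 BB].
have BV x : B x -> B (x^-1) by move=> Bx; rewrite -[x^-1]mul1g; apply: BB.
have BM x y : B x -> B y -> B (x * y).
  by move=> Bx By; rewrite -[y]invgK; apply: BB => //; apply: BV.
pose f (a : G) : set G := [set x | B (a^-1 * x)].
have fE a : f a = [set a * b | b in B].
  apply/seteqP; split=> [x /= Bx|_ [b Bb <-]]; rewrite /f /=.
    by exists (a^-1 * x) => //; rewrite mulKVg.
  by rewrite mulKg.
have of_ a : A a -> open (f a).
  by move=> _; apply: (open_comp _ oB) => x _; exact: mull_continuous.
have covA : A `<=` cover A f.
  by move=> a Aa; exists a => //; rewrite /f /= mulVg.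
pose Gp : ptopologicalType := HB.pack (Topological.sort G)
  (Topological.class G) (isPointed.Build G (1 : G)).
have : @compact Gp A by [].
rewrite compact_cover => /(_ _ A f of_ covA)[D DA covD].
apply: (@sub_finite_set _ _ (f @` [set` D])); last exact: finite_image.
move=> _ [a Aa <-].
have [a' Da' fa'a] := covD a Aa; exists a' => //.
rewrite -fE; apply/seteqP; split=> x; rewrite /f /= in fa'a *.
  by move=> Bx; have := BM _ _ (BV _ fa'a) Bx; rewrite invMg invgK -mulgA mulKVg.
by move=> Bx; have := BM _ _ fa'a Bx; rewrite -mulgA mulKVg.
Qed.

Lemma scale_index_finite (g : G) (U : set G) : compact_open_subgroup U ->
  finite_set (left_cosets (conj_set g U) (conj_set g U `&` U)).
Proof.
move=> [[U1 UU] cU oU].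
have conjE : conj_set g U = [set x | U (g^-1 * x * g)].
  apply/seteqP; split=> [_ [u Uu <-]|x /= Ux] /=.
    by rewrite !mulgA mulVg mul1g mulgKV.
  by exists (g^-1 * x * g) => //; rewrite !mulgA mulgV mul1g mulgK.
apply: finite_left_cosets.
- apply: continuous_compact cU; apply: continuous_subspaceT => x.
  by apply: (@continuous_comp _ _ _ (fun u => g * u) (fun u => u * g^-1));
    [exact: mull_continuous|exact: mulr_continuous].
- apply: openI (oU); rewrite conjE; apply: (open_comp _ oU) => x _.
  by apply: (@continuous_comp _ _ _ (fun u => g^-1 * u) (fun u => u * g));
    [exact: mull_continuous|exact: mulr_continuous].
- rewrite conjE; split; first by split=> //=; rewrite mulg1 mulVg.
  move=> x y [/= Ux xU] [/= Uy yU]; split; last exact: UU.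
  have := UU _ _ Ux Uy; congr U.
  by rewrite !invMg invgK !mulgA mulgK.
Qed.

End FiniteIndex.

(* The tree is nonempty, connected and without circuits; [d] is its degree. *)
Record regularTree (d : nat) := RegularTree {
  vertex :> choiceType ;
  adj : rel vertex ;
  tree_nonempty : [set: vertex] !=set0 ;
  adj_sym : symmetric adj ;
  adj_irr : irreflexive adj ;
  tree_connected : forall u v, exists2 p, path adj u p & last u p = v ;
  tree_acyclic : forall s, (2 < size s)%N -> ~ ucycle adj s ;
  tree_regular : forall v, ([set w | adj v w] #= `I_d)%card
}.
Arguments adj {d T} : rename.

(* The value of [col u v] is only meaningful for adjacent u and v. *)
Record colouring (d : nat) (T : regularTree d) := Colouring {
  col :> T -> T -> 'I_d ;
  col_sym : forall u v, adj u v -> col u v = col v u ;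
  col_bij : forall v, set_bij [set w | adj v w] [set: 'I_d] (col v)
}.

Definition dist (d : nat) (T : regularTree d) (u v : T) : nat :=
  min_nat [set n | exists p, [/\ path adj u p, last u p = v & size p = n]].

Section Automorphisms.
Context {d : nat} (T : regularTree d).

Record treeAut := Aut {
  aut_fun :> T -> T ;
  aut_bij : bijective aut_fun ;
  aut_adj : forall u v, adj (aut_fun u) (aut_fun v) = adj u v
}.

Lemma autP (g h : treeAut) : g =1 h -> g = h.
Proof.
case: g h => [g gb ga] [h hb ha] /= /funext gh; subst h.
by rewrite (Prop_irrelevance gb hb) (Prop_irrelevance ga ha).
Qed.

HB.instance Definition _ := gen_eqMixin treeAut.
HB.instance Definition _ := gen_choiceMixin treeAut.

Definition aut_one : treeAut :=
  @Aut id (Bijective (frefl _) (frefl _)) (fun _ _ => erefl).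

Lemma aut_mul_adj (g h : treeAut) u v : adj (g (h u)) (g (h v)) = adj u v.
Proof. by rewrite !aut_adj. Qed.

Definition aut_mul (g h : treeAut) : treeAut :=
  @Aut (g \o h) (bij_comp (aut_bij g) (aut_bij h)) (aut_mul_adj g h).

Lemma aut_inv_ex (g : treeAut) : exists h : treeAut, cancel g h /\ cancel h g.
Proof.
case: (aut_bij g) => h gh hg.
have hadj u v : adj (h u) (h v) = adj u v by rewrite -(aut_adj g) !hg.
by exists (@Aut h (Bijective hg gh) hadj).
Qed.

Definition aut_inv (g : treeAut) : treeAut := projT1 (cid (aut_inv_ex g)).

Lemma aut_invK (g : treeAut) : cancel g (aut_inv g).
Proof. by rewrite /aut_inv; case: cid => ? []. Qed.

Lemma aut_Kinv (g : treeAut) : cancel (aut_inv g) g.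
Proof. by rewrite /aut_inv; case: cid => ? []. Qed.

Let aut_mulA : associative aut_mul.
Proof. by move=> *; apply: autP. Qed.
Let aut_mul1 : left_id aut_one aut_mul.
Proof. by move=> *; apply: autP. Qed.
Let aut_mul1r : right_id aut_one aut_mul.
Proof. by move=> *; apply: autP. Qed.
Let aut_mulV : left_inverse aut_one aut_inv aut_mul.
Proof. by move=> g; apply: autP => v /=; rewrite aut_invK. Qed.
Let aut_mulrV : right_inverse aut_one aut_inv aut_mul.
Proof. by move=> g; apply: autP => v /=; rewrite aut_Kinv. Qed.

HB.instance Definition _ := isGroup.Build treeAut
  aut_mulA aut_mul1 aut_mul1r aut_mulV aut_mulrV.

Lemma aut1E (v : T) : (1%g : treeAut) v = v. Proof. by []. Qed.
Lemma autME (g h : treeAut) v : (g * h)%g v = g (h v). Proof. by []. Qed.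
Lemma autK (g : treeAut) : cancel g (g^-1)%g. Proof. exact: aut_invK. Qed.
Lemma autKV (g : treeAut) : cancel (g^-1)%g g. Proof. exact: aut_Kinv. Qed.
Lemma aut_inj (g : treeAut) : injective g. Proof. exact: can_inj (autK g). Qed.

(* the permutation topology *)
Definition aut_nbhs (g : treeAut) : set_system treeAut :=
  [set O | exists2 A : set T, finite_set A &
    forall h : treeAut, (forall v, A v -> h v = g v) -> O h].

HB.instance Definition _ := hasNbhs.Build treeAut aut_nbhs.

Let aut_nbhs_filter (g : treeAut) : ProperFilter (nbhs g).
Proof.
apply: Build_ProperFilter_ex; first by move=> O [A _ AO]; exists g; apply: AO.
split; first by exists set0.
  move=> O P [A fA AO] [B fB BP]; exists (A `|` B).
    by rewrite finite_setU.
  by move=> h hg; split; [apply: AO|apply: BP] => v ?; apply: hg; [left|right].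
by move=> O P OP [A fA AO]; exists A => // h /AO/OP.
Qed.

Let aut_nbhs_singleton (g : treeAut) (O : set treeAut) : nbhs g O -> O g.
Proof. by move=> [A _ AO]; apply: AO. Qed.

Let aut_nbhs_nbhs (g : treeAut) (O : set treeAut) : nbhs g O -> nbhs g (nbhs^~ O).
Proof.
move=> [A fA AO]; exists A => // h hg; exists A => // k kh.
by apply: AO => v Av; rewrite kh// hg.
Qed.

HB.instance Definition _ := Nbhs_isNbhsTopological.Build treeAut
  aut_nbhs_filter aut_nbhs_singleton aut_nbhs_nbhs.

Definition elliptic (g : treeAut) :=
  exists A : set T, [/\ finite_set A, A !=set0 & g @` A = A].

Definition hyperbolic (g : treeAut) := ~ elliptic g.

(* For hyperbolic g there is exactly one bi-infinite path that g translates. *)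
Definition axis (g : treeAut) : set T :=
  [set v | exists p : int -> T, exists l : nat,
    [/\ injective p,
        forall i : int, adj (p i) (p (i + 1)%R),
        (0 < l)%N /\ forall i : int, g (p i) = p (i + l%:Z)%R
      & range p v]].

Definition axis_proj (g : treeAut) (v : T) : T :=
  xget v [set w | axis g w /\
                  forall u, axis g u -> (dist v w <= dist v u)%N].

End Automorphisms.

Section LocalAction.
Context {d : nat} {T : regularTree d} (c : colouring T).

(* the inverse of the restriction of c to E(v) *)
Definition nbr (v : T) (i : 'I_d) : T := xget v [set w | adj v w /\ c v w = i].

Lemma nbrP v i : adj v (nbr v i) /\ c v (nbr v i) = i.
Proof.
have [_ _ /(_ i I)[w vw cw]] := col_bij c v.
by apply: (@xgetPex _ v [set w | adj v w /\ c v w = i]); exists w.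
Qed.

Lemma adj_nbr v i : adj v (nbr v i). Proof. by case: (nbrP v i). Qed.
Lemma col_nbr v i : c v (nbr v i) = i. Proof. by case: (nbrP v i). Qed.

Lemma col_inj v u w : adj v u -> adj v w -> c v u = c v w -> u = w.
Proof.
by have [_ inj _] := col_bij c v => vu vw; apply: inj; rewrite inE.
Qed.

Lemma nbrK v w : adj v w -> nbr v (c v w) = w.
Proof. by move=> vw; apply: (col_inj (adj_nbr _ _) vw); rewrite col_nbr. Qed.

(* [h] need not be an automorphism of the tree, so that [sigma] also applies to
   automorphisms of subtrees; the default value 1 is never used at the vertices
   considered there, see [sigmaE] and [sigma_subE]. *)
Definition sigma (h : T -> T) (v : T) : 'S_d :=
  insubd (1%g : 'S_d) [ffun i => c (h v) (h (nbr v i))].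

Lemma sigmaE_inj (h : T -> T) v :
  (forall i, adj (h v) (h (nbr v i))) -> injective (fun i => h (nbr v i)) ->
  forall i, sigma h v i = c (h v) (h (nbr v i)).
Proof.
move=> hadj hinj i.
have inj : injectiveb [ffun i => c (h v) (h (nbr v i))].
  apply/injectiveP => j k; rewrite !ffunE => /col_inj.
  by move=> /(_ (hadj j) (hadj k))/hinj.
by rewrite -pvalE /sigma val_insubd inj ffunE.
Qed.

Lemma nbr_inj v : injective (nbr v).
Proof. by move=> i j ij; rewrite -(col_nbr v i) ij col_nbr. Qed.

Lemma sigmaE (g : treeAut T) v i : sigma g v i = c (g v) (g (nbr v i)).
Proof.
apply: sigmaE_inj => [j|j k /aut_inj/nbr_inj//]; rewrite aut_adj; exact: adj_nbr.
Qed.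

(* Permutations compose from left to right in 'S_d, whereas in [treeAut T] we have
   (g * h) v = g (h v). *)
Lemma sigmaM (g h : treeAut T) v :
  sigma (g * h)%g v = (sigma h v * sigma g (h v))%g.
Proof.
apply/permP => i; rewrite permM !sigmaE !autME nbrK// aut_adj; exact: adj_nbr.
Qed.

Lemma sigma1 v : sigma (1%g : treeAut T) v = 1%g.
Proof. by apply/permP => i; rewrite sigmaE perm1 !aut1E col_nbr. Qed.

Lemma sigmaV (g : treeAut T) v : sigma (g^-1)%g v = ((sigma g (g^-1%g v))^-1)%g.
Proof.
have := sigmaM (g^-1)%g g (g^-1%g v); rewrite mulVg sigma1 autKV => e.
by apply/eqP; rewrite eq_sym eq_invg_mul -e.
Qed.

End LocalAction.

Section UniversalGroups.
Context {d : nat} {T : regularTree d} (c : colouring T).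
Implicit Types F : {group 'S_d}.

Definition universal_group F : set (treeAut T) :=
  [set g | forall v, sigma c g v \in F].

Definition singularities F (g : treeAut T) : set T := [set v | sigma c g v \notin F].

Definition fixer F (A : set T) : set (treeAut T) :=
  [set g | universal_group F g /\ forall v, A v -> g v = v].

Definition GFF_pred F F' : pred (treeAut T) :=
  [pred g | `[< universal_group F' g /\ finite_set (singularities F g) >]].

Record GFF F F' := MkGFF { GFF_aut :> treeAut T ; _ : GFF_pred F F' GFF_aut }.

HB.instance Definition _ F F' := [isSub for @GFF_aut F F'].
HB.instance Definition _ F F' := [Choice of GFF F F' by <:].

Lemma universalM F g h : universal_group F g -> universal_group F h ->
  universal_group F (g * h)%g.
Proof. by move=> Fg Fh v; rewrite sigmaM groupM. Qed.

Lemma universalV F g : universal_group F g -> universal_group F (g^-1)%g.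
Proof. by move=> Fg v; rewrite sigmaV groupV. Qed.

Lemma universal1 F : universal_group F 1%g.
Proof. by move=> v; rewrite sigma1 group1. Qed.

Let GFF_closed F F' : group_closed (GFF_pred F F').
Proof.
split=> [|g h]; rewrite -!topredE /=.
  apply/asboolP; split; first exact: universal1.
  rewrite (_ : singularities _ _ = set0)//; apply/seteqP; split=> // v.
  by rewrite /singularities /= sigma1 group1.
move=> /asboolP[Fg Sg] /asboolP[Fh Sh]; apply/asboolP; split.
  by apply: universalM => //; apply: universalV.
apply: (@sub_finite_set _ _ (h @` (singularities F g) `|` h @` (singularities F h))).
  move=> v; rewrite /singularities /= sigmaM sigmaV => nF.
  have [gF|gF] := boolP (sigma c g (h^-1%g v) \in F); last first.
    by left; exists (h^-1%g v); rewrite ?autKV.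
  right; exists (h^-1%g v); rewrite ?autKV//=.
  by apply: contra nF => hF; rewrite groupM ?groupV.
by rewrite finite_setU; split; apply: finite_image.
Qed.

HB.instance Definition _ F F' :=
  SubChoice_isSubGroup.Build (treeAut T) (GFF_pred F F') (GFF F F')
    (@GFF_closed F F').

Lemma universal_GFF F F' g : F \subset F' -> universal_group F g ->
  GFF_pred F F' g.
Proof.
move=> /fintype.subsetP sFF' Fg; apply/asboolP; split.
  by move=> v; apply: sFF'.
rewrite (_ : singularities F g = set0)//; apply/seteqP; split=> // v.
by rewrite /singularities /= Fg.
Qed.

Lemma GFFM F F' (g h : GFF F F') :
  GFF_aut (g * h)%g = (GFF_aut g * GFF_aut h)%g.
Proof. exact: valM. Qed.

Lemma GFFV F F' (g : GFF F F') : GFF_aut (g^-1)%g = ((GFF_aut g)^-1)%g.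
Proof. by apply: (mulgI (GFF_aut g)); rewrite -GFFM !mulgV. Qed.

Lemma fixer1 F A : fixer F A 1%g.
Proof. by split=> //; exact: universal1. Qed.

Lemma fixerM F A g h : fixer F A g -> fixer F A h -> fixer F A (g * h)%g.
Proof.
move=> [Fg gA] [Fh hA]; split; first exact: universalM.
by move=> v Av; rewrite autME hA// gA.
Qed.

Lemma fixerV F A g : fixer F A g -> fixer F A (g^-1)%g.
Proof.
move=> [Fg gA]; split; first exact: universalV.
by move=> v Av; apply: (@aut_inj _ _ g); rewrite autKV gA.
Qed.

Lemma fixerS F A B g : A `<=` B -> fixer F B g -> fixer F A g.
Proof. by move=> AB [Fg gB]; split=> // v /AB/gB. Qed.

Lemma fixer_conj F F' (h : GFF F F') (A : set T) : finite_set A ->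
  exists2 B : set T, finite_set B &
    forall u, fixer F B u -> fixer F A ((GFF_aut h)^-1 * u * GFF_aut h)%g.
Proof.
move=> fA; case: h => h /= /asboolP[_ Sh].
pose B : set T := h @` (A `|` singularities F h).
pose C : set T :=
  \bigcup_(i in [set: 'I_d]) ((fun v => nbr c (h v) i) @` singularities F h).
exists (B `|` C).
  rewrite finite_setU; split; first by apply: finite_image; rewrite finite_setU.
  by apply: bigcup_finite => // i _; exact: finite_image.
move=> u [Fu uBC]; split; last first.
  move=> v Av; rewrite !autME uBC ?autK//.
  by left; exists v => //; left.
move=> v; rewrite !sigmaM sigmaV.
have [hv|hv] := boolP (sigma c h v \in F); last first.
  have uhv : u (h v) = h v by apply: uBC; left; exists v => //; right.
  have -> : sigma c u (h v) = 1%g.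
    apply/permP => i; rewrite sigmaE perm1 uhv uBC ?col_nbr//.
    by right; exists i => //; exists v.
  by rewrite uhv autK mul1g mulgV group1.
rewrite !groupM// ?groupV//; apply/negPn/negP => nF; case/negP: (nF).
pose w := (h^-1)%g (u (h v)).
have : u (h w) = h w by apply: uBC; left; exists w => //; right.
rewrite /w autKV => /aut_inj uhv.
by rewrite uhv autK.
Qed.

(* The pointwise stabilisers in U(F) of finite sets of vertices form a basis of
   neighbourhoods of 1; see [GFF_subspace] for the comparison with U(F). *)
Definition GFF_nbhs F F' (g : GFF F F') : set_system (GFF F F') :=
  [set O | exists2 A : set T, finite_set A &
    forall h : GFF F F', fixer F A (GFF_aut (g^-1 * h)%g) -> O h].

HB.instance Definition _ F F' := hasNbhs.Build (GFF F F') (@GFF_nbhs F F').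

Let GFF_nbhs_singleton F F' (g : GFF F F') (O : set (GFF F F')) :
  nbhs g O -> O g.
Proof. by move=> [A _ AO]; apply: AO; rewrite mulVg; exact: fixer1. Qed.

Let GFF_nbhs_filter F F' (g : GFF F F') : ProperFilter (nbhs g).
Proof.
apply: Build_ProperFilter_ex => [O /GFF_nbhs_singleton Og|]; first by exists g.
split; first by exists set0.
  move=> O P [A fA AO] [B fB BP]; exists (A `|` B).
    by rewrite finite_setU.
  by move=> h gh; split; [apply: AO|apply: BP]; apply: fixerS gh => ? ?;
    [left|right].
by move=> O P OP [A fA AO]; exists A => // h /AO/OP.
Qed.

Let GFF_nbhs_nbhs F F' (g : GFF F F') (O : set (GFF F F')) :
  nbhs g O -> nbhs g (nbhs^~ O).
Proof.
move=> [A fA AO]; exists A => // h gh; exists A => // k hk.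
apply: AO; rewrite (_ : (g^-1 * k = g^-1 * h * (h^-1 * k))%g).
  by rewrite GFFM; exact: fixerM.
by rewrite -mulgA mulKVg.
Qed.

HB.instance Definition _ F F' := Nbhs_isNbhsTopological.Build (GFF F F')
  (@GFF_nbhs_filter F F') (@GFF_nbhs_singleton F F') (@GFF_nbhs_nbhs F F').

Let GFF_mul_continuous F F' :
  continuous (fun x : GFF F F' * GFF F F' => (x.1 * x.2)%g).
Proof.
move=> [g h] O /= [A fA AO]; have [B fB BA] := fixer_conj h fA.
exists ([set g' | fixer F B (GFF_aut (g^-1 * g')%g)],
        [set h' | fixer F A (GFF_aut (h^-1 * h')%g)]) => /=.
  by split; [exists B|exists A].
move=> [g' h'] /= [gg' hh']; apply: AO.
rewrite (_ : ((g * h)^-1 * (g' * h') = h^-1 * (g^-1 * g') * h * (h^-1 * h'))%g).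
  by rewrite GFFM; apply: fixerM => //; rewrite !GFFM GFFV -!GFFM; exact: BA.
by rewrite invMg !mulgA mulgK.
Qed.

Let GFF_inv_continuous F F' : continuous (fun x : GFF F F' => (x^-1)%g).
Proof.
move=> g O /= [A fA AO]; have [B fB BA] := fixer_conj (g^-1)%g fA.
exists B => // g' gg'; apply: AO.
have := BA _ (fixerV gg'); rewrite -!GFFV -!GFFM; congr (fixer _ _ (GFF_aut _)).
by rewrite invMg !invgK !mulgA mulgK.
Qed.

HB.instance Definition _ F F' := isTopologicalGroup.Build (GFF F F')
  (@GFF_mul_continuous F F') (@GFF_inv_continuous F F').

(* The inclusion of U(F), with the permutation topology, is continuous and
   open. *)
Lemma GFF_subspace F F' (W : set (GFF F F')) :
  (forall g, W g -> universal_group F g) ->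
  open W <-> exists2 O : set (treeAut T), open O &
               W = [set g | O (GFF_aut g) /\ universal_group F g].
Proof.
move=> WF; split=> [oW|[O oO ->]].
  pose good (g : GFF F F') A := [/\ W g, finite_set A &
    forall h : GFF F F', fixer F A (GFF_aut (g^-1 * h)%g) -> W h].
  exists [set h : treeAut T | exists g A, good g A /\ forall v, A v -> h v = g v].
    rewrite openE => h [g [A [gA hg]]]; have [_ fA _] := gA.
    exists A => // k kh; exists g, A; split=> // v Av; by rewrite kh// hg.
  apply/seteqP; split=> [g Wg|g [[k [A [[Wk fA AW] gk]] Fg]]].
    split; last exact: WF.
    by move: oW; rewrite openE => /(_ _ Wg)[A fA AW]; exists g, A.
  apply: AW; rewrite GFFM GFFV; split.
    by apply: universalM => //; apply: universalV; exact: WF.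
  by move=> v Av; rewrite autME gk// autK.
rewrite openE => g [Og Fg]; move: oO; rewrite openE => /(_ _ Og)[A fA AO].
exists A => // h; rewrite GFFM GFFV => -[Fgh ghA]; split.
  by apply: AO => v Av; rewrite -[in RHS](ghA v Av) autME autKV.
have -> : GFF_aut h = (GFF_aut g * ((GFF_aut g)^-1 * GFF_aut h))%g.
  by rewrite mulKVg.
exact: universalM.
Qed.

End UniversalGroups.

Section Subtrees.
Context {d : nat} {T : regularTree d}.

Record subgraph := Subgraph { verts : set T ; edges : set (T * T) }.
Implicit Types S : subgraph.

Definition subgraph_le S S' := verts S `<=` verts S' /\ edges S `<=` edges S'.

(* A subgraph of a tree has no circuits, so connectedness suffices. *)
Definition subtree S :=
  [/\ verts S !=set0,
      forall u v, edges S (u, v) -> [/\ adj u v, verts S u & verts S v],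
      forall u v, edges S (u, v) -> edges S (v, u)
    & forall u v, verts S u -> verts S v ->
        exists2 p, path (fun x y => `[< edges S (x, y) >]) u p & last u p = v].

Definition complete_subtree S := subtree S /\
  forall v, verts S v ->
    (forall w, adj v w -> verts S w) \/ (exists! w, edges S (v, w)).

Definition internal S : set T :=
  [set v | verts S v /\ forall w, adj v w -> edges S (v, w)].

Definition aut_image (g : treeAut T) S : subgraph :=
  Subgraph (g @` verts S) [set (g e.1, g e.2) | e in edges S].

Record pando (c : colouring T) (F : {group 'S_d}) (g : treeAut T) (P : subgraph) :=
  Pando {
    pando_complete : complete_subtree P ;
    pando_finite : finite_set (verts P) ;
    pando_sing : singularities c F g `<=` internal P ;
    pando_axis : exists v, [/\ axis g v, verts P v & internal P (g v)] ;
    pando_ball : forall v, internal P (axis_proj g v) ->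
      (exists2 u, verts P u &
        dist u (axis_proj g u) = dist v (axis_proj g v)) -> verts P v
  }.

Definition initial_segment (g : treeAut T) (P P0 : subgraph) :=
  let D := Subgraph (verts P `\` verts (aut_image g P))
                    (edges P `\` edges (aut_image g P)) in
  [/\ complete_subtree P0, subgraph_le D P0
    & forall S, complete_subtree S -> subgraph_le D S -> subgraph_le P0 S].

(* An automorphism of S is extended by the identity outside S, so that distinct
   automorphisms are distinct functions on T. *)
Definition subtree_aut S : set (T -> T) :=
  [set a | [/\ set_bij (verts S) (verts S) a,
               forall u v, verts S u -> verts S v ->
                 (edges S (a u, a v) <-> edges S (u, v))
             & forall v, ~ verts S v -> a v = v]].

Lemma sigma_subE (c : colouring T) S a v i : subtree S -> subtree_aut S a ->
  internal S v -> sigma c a v i = c (a v) (a (nbr c v i)).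
Proof.
move=> [_ Sadj _ _] [[aS ainj _] aE _] [Sv vS].
have Snbr j : edges S (v, nbr c v j) by apply: vS; exact: adj_nbr.
have Sw j : verts S (nbr c v j) by have [] := Sadj _ _ (Snbr j).
apply: sigmaE_inj => [j|j k /= jk].
  by have [] := Sadj _ _ ((aE _ _ Sv (Sw j)).2 (Snbr j)).
by apply: (@nbr_inj _ _ c v); apply: ainj jk; rewrite inE.
Qed.

(* As products in 'S_d are read from left to right, this is the set written
   sigma(g^k, a(v))^-1 F sigma(g^k, v) \cap F with functional composition. *)
Definition Mset (c : colouring T) (F : {group 'S_d}) (g : treeAut T)
    (P0 : subgraph) : set (T -> T) :=
  [set a | [/\ subtree_aut P0 a,
    forall v, axis g v -> verts P0 v -> a v = v
  & \forall k \near \oo, forall v, internal P0 v ->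
      sigma c a v \in
        (sigma c (g ^+ k)%g v *: (F : {set 'S_d}) :*
           (sigma c (g ^+ k)%g (a v))^-1 :&: F)%g]].

End Subtrees.

(* Main.v *)
Require Import Defs.
From mathcomp Require Import all_boot all_order all_algebra all_fingroup.
From mathcomp Require Import finmap zify.
From mathcomp Require Import all_classical topology.

(** Let l be the translation length of g, and number the vertices of its axis
    so that g p_i = p_(i+l) and the pando P meets the axis in p_0, ..., p_b;
    then b > l. Give each vertex a level, the index of the axis vertex nearest
    to it, and a height, its distance to the axis. The conditions on P say
    that P is a tube: all vertices with 0 < level < b and height at most some
    r, together with p_0 and p_b ([pando_frame]). The singularities of g have
    0 < level < b and height < r.

    The stabiliser U_P need not minimise the index. Call x good at v if g^n x
    g^-n has local action in F at g^n v whenever |n| is large, and let V(a,e)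
    be the group of those x that fix p_a, ..., p_e, are good at the vertices
    with a < level < e and height < r, and have local action in F at all
    others ([tidy]). Goodness is carried along by g. As g has no singularities
    at levels >= b, and the inverse of g has none at levels <= l, the forward
    half of goodness at the former levels and the backward half at the latter
    both just mean local action in F. So with V = V(0,b), conjugation by g
    turns V(a,e) into V(a+l,e+l) for a <= 0 and e >= b ([tidy_conj]), and V
    meets its conjugate by g^-n in V(-nl,b) ([tidy_powers]). The indices of
    these intersections in V are therefore the exact powers of s = [V(l,b+l) :
    V(0,b+l)]. Any compact open subgroup U is commensurate with V, so s^n is
    at most a constant times the n-th power of the index that U contributes to
    the scale; this makes s minimal ([scale_of_tidy]).

    It remains to compute s. An element that fixes the edge from p_l to
    p_(l+1) is a product of one supported on the levels <= l and one supported
    on the levels > l, with the same local actions ([split_at]). Let H be the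
    group of elements of U(F) that fix p_l and all levels > l, H0 its
    intersection with V, and H1 the subgroup of those elements that also fix P
    pointwise. Splitting gives s = [H : H0] ([transversal_tidy]) and [U_gP :
    U_(P u gP)] = [H : H1] ([transversal_fixer]). Restricting to the initial
    segment P0 identifies the cosets of H1 in H0 with the set M of the
    statement ([MsetE]): restrictions lie in M because goodness is the
    condition defining M, and all of M arises because an automorphism of P0
    with local actions in F extends to the whole tree by repeating, along each
    branch, the last local action that it prescribes ([ext_restriction]).
    Hence [U_gP : U_(P u gP)] = s |M|. *)

Set Implicit Arguments.
Unset Strict Implicit.
Unset Printing Implicit Defensive.

Import Order.TTheory GRing.Theory Num.Theory.

Local Open Scope classical_set_scope.

(** * Coset representatives and indices *)

Section Index.
Local Open Scope group_scope.
Variable G : groupType.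
Implicit Types (A B C D U V : set G) (I J : finType) (x a b : G).

Lemma subgroup1 B : subgroup B -> B 1. Proof. by case. Qed.

Lemma subgroupV B x : subgroup B -> B x -> B x^-1.
Proof. by move=> [B1 BB] Bx; rewrite -[x^-1]mul1g; apply: BB. Qed.

Lemma subgroupM B x a : subgroup B -> B x -> B a -> B (x * a).
Proof.
by move=> sB Bx Ba; rewrite -[a]invgK; apply: sB.2 => //; apply: subgroupV.
Qed.

Lemma subgroupVM B x a : subgroup B -> B x -> B a -> B (x^-1 * a).
Proof. by move=> sB Bx; apply: subgroupM => //; exact: subgroupV. Qed.

Lemma subgroupI A B : subgroup A -> subgroup B -> subgroup (A `&` B).
Proof.
move=> sA sB; split; first by split; exact: subgroup1.
by move=> x y [? ?] [? ?]; split; [apply: sA.2|apply: sB.2].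
Qed.

Lemma conj_setE x U : conj_set x U = [set a | U (x^-1 * a * x)].
Proof.
apply/seteqP; split=> [_ [u Uu <-]|a /= Ua] /=.
  by rewrite !mulgA mulVg mul1g mulgKV.
by exists (x^-1 * a * x) => //; rewrite !mulgA mulgV mul1g mulgK.
Qed.

Lemma conj_set1 U : conj_set 1 U = U.
Proof. by rewrite conj_setE; apply/seteqP; split=> a /=; rewrite invg1 mul1g mulg1. Qed.

Lemma conj_setM x y U : conj_set (x * y) U = conj_set x (conj_set y U).
Proof.
by rewrite !conj_setE; apply/seteqP; split=> a /=; rewrite invMg !mulgA.
Qed.

Lemma conj_setI x U V : conj_set x (U `&` V) = conj_set x U `&` conj_set x V.
Proof. by rewrite !conj_setE. Qed.

Lemma subgroup_conj x U : subgroup U -> subgroup (conj_set x U).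
Proof.
move=> sU; rewrite conj_setE; split=> /=.
  by rewrite mulg1 mulVg; exact: subgroup1.
move=> a b Ua Ub; have := sU.2 _ _ Ua Ub; congr (U _).
by rewrite !invMg invgK !mulgA mulgK.
Qed.

(** Coset representatives are families indexed by a finite type: products of
    index types then do the counting, and covering and separation can be used
    apart, the first for upper and the second for lower bounds on an index. *)
Definition left_covers A B I (t : I -> G) := forall a, A a -> exists i, B ((t i)^-1 * a).

Definition left_separated A B I (t : I -> G) :=
  (forall i, A (t i)) /\ forall i j, B ((t i)^-1 * t j) -> i = j.

Definition left_transversal A B I (t : I -> G) := left_separated A B t /\ left_covers A B t.

Lemma left_cosetE a B : [set a * b | b in B] = [set x | B (a^-1 * x)].
Proof.
apply/seteqP; split=> [_ [b Bb <-]|x /= Bx] /=; first by rewrite mulKg.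
by exists (a^-1 * x) => //; rewrite mulKVg.
Qed.

Lemma index_transversal A B I (t : I -> G) : subgroup B ->
  left_transversal A B t -> group_index A B = #|I|.
Proof.
move=> sB [[At tinj] tcov]; rewrite /group_index /card_set.
apply: card_fset_set.
have -> : left_cosets A B = (fun i => [set t i * b | b in B]) @` [set: I].
  apply/seteqP; split=> [_ [a Aa <-]|_ [i _ <-]]; last by exists (t i).
  have [i Bi] := tcov a Aa; exists i => //; rewrite !left_cosetE.
  apply/seteqP; split=> x /= Bx.
    have := subgroupM sB (subgroupV sB Bi) Bx.
    by rewrite invMg invgK -mulgA mulKVg.
  by have := subgroupM sB Bi Bx; rewrite -mulgA mulKVg.
have cI : ([set: I] #= `I_#|I|)%card.
  have <- : (fun i : I => enum_rank i : nat) @` [set: I] = `I_#|I|.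
    apply/seteqP; split=> [_ [i _ <-]|k /= kI] /=; first exact: ltn_ord.
    by exists (enum_val (Ordinal kI)); rewrite ?enum_valK.
  rewrite card_eq_sym; apply: inj_card_eq => i j _ _.
  by move=> /ord_inj/enum_rank_inj.
rewrite (card_eql (inj_card_eq _))//.
move=> i j _ _; rewrite !left_cosetE => /seteqP[_ sub]; apply: tinj.
by apply: sub => /=; rewrite mulVg; exact: subgroup1.
Qed.

Lemma transversal_of_finite A B : subgroup B -> finite_set (left_cosets A B) ->
  exists (I : finType) (t : I -> G), left_transversal A B t.
Proof.
move=> sB fin; pose I : finType := fset_set (left_cosets A B).
have tP (i : I) : exists a, A a /\ [set a * b | b in B] = val i.
  have := valP i; rewrite in_fset_set// inE => -[a Aa <-].
  by exists a.
have [t tE] := choice tP; exists I, t; split; last first.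
  move=> a Aa.
  have iP : [set a * b | b in B] \in fset_set (left_cosets A B).
    by rewrite in_fset_set// inE; exists a.
  pose i : I := [` iP]%fset.
  have := (tE i).2; rewrite /= !left_cosetE => /seteqP[_ sub]; exists i.
  by apply: sub => /=; rewrite mulVg; exact: subgroup1.
split=> [i|i j Bij]; first exact: (tE i).1.
apply/val_inj; rewrite -(tE i).2 -(tE j).2 !left_cosetE.
apply/seteqP; split=> x /= Bx.
  have := subgroupM sB (subgroupV sB Bij) Bx.
  by rewrite invMg invgK -mulgA mulKVg.
by have := subgroupM sB Bij Bx; rewrite -mulgA mulKVg.
Qed.

Lemma coversM A B C I J (t : I -> G) (u : J -> G) :
  left_covers A B t -> left_covers B C u -> left_covers A C (fun ij : I * J => t ij.1 * u ij.2).
Proof.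
move=> tc uc a /tc[i /uc[j Cij]]; exists (i, j) => /=.
by rewrite invMg -mulgA.
Qed.

Lemma separatedM A B C I J (t : I -> G) (u : J -> G) :
  subgroup A -> subgroup B -> B `<=` A -> C `<=` B ->
  left_separated A B t -> left_separated B C u ->
  left_separated A C (fun ij : I * J => t ij.1 * u ij.2).
Proof.
move=> sA sB BA CB [At tinj] [Bu uinj]; split=> [[i j] /=|[i j] [i' j'] /= Ct].
  by apply: subgroupM => //; apply: BA.
have ii' : i = i'.
  apply: tinj; have := subgroupM sB (subgroupM sB (Bu j) (CB _ Ct)) (subgroupV sB (Bu j')).
  by rewrite invMg !mulgA mulgV mul1g mulgK.
rewrite -ii'; congr pair; apply: uinj; move: Ct.
by rewrite -ii' invMg -!mulgA mulKg.
Qed.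

Lemma transversalM A B C I J (t : I -> G) (u : J -> G) :
  subgroup A -> subgroup B -> B `<=` A -> C `<=` B ->
  left_transversal A B t -> left_transversal B C u ->
  left_transversal A C (fun ij : I * J => t ij.1 * u ij.2).
Proof.
by move=> ? ? ? ? [? ?] [? ?]; split; [exact: (@separatedM A B C)|exact: (@coversM A B C)].
Qed.

(** Each coset that meets D is represented by one of its elements in D. *)
Lemma covers_setI A B D I (t : I -> G) : subgroup B -> subgroup D ->
  left_covers A B t -> exists u : I -> G, left_covers (A `&` D) (B `&` D) u.
Proof.
move=> sB sD tc.
have uP i : exists b, (exists2 a, (A `&` D) a & B ((t i)^-1 * a)) ->
    (A `&` D) b /\ B ((t i)^-1 * b).
  have [[a ADa Ba]|no] := pselect (exists2 a, (A `&` D) a & B ((t i)^-1 * a)).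
    by exists a.
  by exists 1.
have [u uE] := choice uP; exists u => a [Aa Da].
have [i Bi] := tc a Aa; exists i.
have [[Au Du] Bu] := uE i (ex_intro2 _ _ a (conj Aa Da) Bi).
split; last by apply: subgroupM => //; apply: subgroupV.
have := subgroupM sB (subgroupV sB Bu) Bi.
by rewrite invMg invgK -mulgA mulKVg.
Qed.

Lemma covers_conj x A B I (t : I -> G) : left_covers A B t ->
  left_covers (conj_set x A) (conj_set x B) (fun i => x * t i * x^-1).
Proof.
rewrite !conj_setE => tc a /tc[i Bi]; exists i => /=; move: Bi; congr B.
by rewrite !invMg invgK !mulgA mulVg mul1g.
Qed.

Lemma separated_conj x A B I (t : I -> G) : left_separated A B t ->
  left_separated (conj_set x A) (conj_set x B) (fun i => x * t i * x^-1).
Proof.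
rewrite !conj_setE => -[At tinj]; split=> [i /=|i j /= Bij].
  by rewrite !mulgA mulVg mul1g mulgKV.
apply: tinj; move: Bij; congr B.
by rewrite !invMg invgK !mulgA mulVg mul1g mulgKV mulgKV.
Qed.

Lemma leq_separated_covers A B I J (t : I -> G) (u : J -> G) : subgroup B ->
  left_separated A B t -> left_covers A B u -> (#|I| <= #|J|)%N.
Proof.
move=> sB [At tinj] uc.
have [f fE] := choice (fun i => uc _ (At i)).
apply: (@leq_card _ _ f) => i j fij; apply: tinj.
have := subgroupM sB (subgroupV sB (fE i)) (fE j).
by rewrite fij invMg invgK -mulgA mulKVg.
Qed.

End Index.

(** By Bernoulli, (t + 1)^n outgrows C t^n; the exponent n = C t is large
    enough for this. *)
Lemma leq_of_exp_leq C s t : (forall n, s ^ n <= C * t ^ n)%N -> (s <= t)%N.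
Proof.
move=> le; rewrite leqNgt; apply/negP => ts.
have [t0|t0] := posnP t; first by have := le 1%N; rewrite t0 muln0; lia.
have bern n : (t ^ n * (t + n) <= t * t.+1 ^ n)%N.
  elim: n => [|n IHn]; first by rewrite !expn0; lia.
  rewrite !expnSr mulnA; apply: leq_trans (leq_mul IHn (leqnn t.+1)).
  by rewrite -!mulnA leq_mul2l; apply/orP; right; nia.
have := bern (C * t)%N; have := le (C * t)%N.
have : (t.+1 ^ (C * t) <= s ^ (C * t))%N by case: (C * t)%N => [|k]; rewrite ?expn0// leq_exp2r.
have : (0 < t ^ (C * t))%N by rewrite expn_gt0 t0.
move: (t ^ _)%N (s ^ _)%N (t.+1 ^ _)%N => X Y Z; nia.
Qed.

(** * A criterion for minimising the index *)

Section ScaleMin.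
Local Open Scope group_scope.

Lemma covers_sub (G : groupType) (A B B' : set G) (I : finType) (t : I -> G) :
  B `<=` B' -> left_covers A B t -> left_covers A B' t.
Proof. by move=> BB' tc a /tc[i /BB' ?]; exists i. Qed.

(** Conjugating the cover of U by x^n and intersecting with U refines the n-th
    cover to the next one, at the cost of the same factor. *)
Lemma covers_iterate (G : groupType) (x : G) (U : set G) (I : finType)
    (t : I -> G) n : subgroup U -> left_covers U (U `&` conj_set x U) t ->
  exists (K : finType) (w : K -> G),
    #|K| = (#|I| ^ n)%N /\ left_covers U (U `&` conj_set (x ^+ n) U) w.
Proof.
move=> sU tc; elim: n => [|n [K [w [cK wc]]]].
  exists unit, (fun=> 1); rewrite card_unit expn0; split=> // a Ua; exists tt.
  by rewrite expg0 conj_set1 setIid invg1 mul1g.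
have sUn k := subgroup_conj (x ^+ k) sU.
have := @covers_conj _ (x ^+ n) _ _ _ _ tc; rewrite conj_setI -conj_setM -expgSr => tnc.
have [u uc] := covers_setI (subgroupI (sUn n) (sUn n.+1)) sU tnc.
exists (K * I)%type, (fun ki => w ki.1 * u ki.2); split.
  by rewrite card_prod cK expnSr.
apply: coversM wc _; rewrite setIC; apply: covers_sub uc => y [[_ ?] ?].
by split.
Qed.

(** Passing from V to U and back costs constant factors only, while the index
    of U is at most multiplied by the same number at each step; so the growth
    rate of the powers for V bounds that number from below. *)
Lemma leq_index_of_powers (G : groupType) (x : G) (U V : set G) (s : nat)
    (I J1 J2 : finType) (t : I -> G) (u1 : J1 -> G) (u2 : J2 -> G) :
  subgroup U -> subgroup V ->
  left_covers U (U `&` conj_set x U) t -> left_covers V (V `&` U) u1 ->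
  left_covers U (U `&` V) u2 ->
  (forall n, exists (K : finType) (w : K -> G),
     #|K| = (s ^ n)%N /\ left_separated V (V `&` conj_set (x ^+ n) V) w) ->
  (s <= #|I|)%N.
Proof.
move=> sU sV tc u1c u2c wP; apply: (@leq_of_exp_leq (#|J1| * #|J2|)) => n.
have [K [w [<- wsep]]] := wP n.
have [L [v [cL vc]]] := covers_iterate n sU tc.
have sUn := subgroup_conj (x ^+ n) sU; have sVn := subgroup_conj (x ^+ n) sV.
have [v' v'c] := covers_setI (subgroupI sU sUn) sV vc.
have := @covers_conj _ (x ^+ n) _ _ _ _ u2c; rewrite conj_setI => u2nc.
have [u2' u2'c] := covers_setI (subgroupI sUn sVn) (subgroupI sU sV) u2nc.
rewrite setIC in v'c.
have c1 := coversM u1c v'c.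
have c2 : left_covers V (V `&` conj_set (x ^+ n) V)
    (fun k : (J1 * L) * J2 => u1 k.1.1 * v' k.1.2 * u2' k.2).
  apply: coversM c1 _ => a [[Ua Una] Va].
  have [i [[_ Vni] [_ Vi]]] := u2'c a (conj Una (conj Ua Va)).
  by exists i; split.
have := leq_separated_covers (subgroupI sV sVn) wsep c2.
by rewrite !card_prod cL -!mulnA (mulnC #|J2|).
Qed.

(** The criterion for a subgroup to minimise the index: its own indices must
    be multiplicative along the powers of g. *)
Lemma scale_of_tidy (G : topGroupType) (g : G) (V : set G) (I : finType)
    (t : I -> G) : compact_open_subgroup V ->
  left_transversal (conj_set g V) (conj_set g V `&` V) t ->
  (forall n, exists (K : finType) (w : K -> G), #|K| = (#|I| ^ n)%N /\
     left_separated V (V `&` conj_set (g^-1 ^+ n) V) w) ->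
  scale g = #|I|.
Proof.
move=> coV tV powers; have [sV cV oV] := coV.
have sgV := subgroup_conj g sV.
rewrite /scale; set ind := [set _ | _ in _].
have indV : ind #|I|.
  by exists V => //; rewrite (index_transversal _ tV)//; exact: subgroupI.
have [[U coU eU] minU] := min_natP (ex_intro _ _ indV).
have [sU cU oU] := coU; have sgU := subgroup_conj g sU.
have [J [u tu]] := transversal_of_finite (subgroupI sgU sU) (scale_index_finite g coU).
apply/eqP; rewrite eqn_leq minU//=.
rewrite -eU (index_transversal (subgroupI sgU sU) tu).
have [_ /(@covers_conj _ g^-1)] := tu; rewrite conj_setI -conj_setM mulVg conj_set1.
move=> uc.
have [J1 [v1 [_ v1c]]] := transversal_of_finite (subgroupI sV sU)
  (finite_left_cosets cV (openI oV oU) (subgroupI sV sU)).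
have [J2 [v2 [_ v2c]]] := transversal_of_finite (subgroupI sU sV)
  (finite_left_cosets cU (openI oU oV) (subgroupI sU sV)).
exact: leq_index_of_powers sU sV uc v1c v2c powers.
Qed.

End ScaleMin.

(** * Paths in a tree *)

Section Trees.
Context {d : nat} {T : regularTree d}.
Implicit Types (u v w : T) (E : set T) (q : seq T).

Lemma adj_neq u v : adj u v -> u <> v.
Proof. by move=> uv e; move: uv; rewrite e adj_irr. Qed.

(** Paths confined to a set of vertices: connectivity statements such as being
    on one side of an edge or avoiding a vertex are instances. *)
Definition joined E u v :=
  exists q, [/\ path adj u q, last u q = v & forall x, x \in u :: q -> E x].

Lemma joined_refl E u : E u -> joined E u u.
Proof. by move=> Eu; exists [::]; split=> // x; rewrite inE => /eqP->. Qed.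

Lemma joined_step E u v : adj u v -> E u -> E v -> joined E u v.
Proof.
move=> uv Eu Ev; exists [:: v]; split; rewrite /= ?uv//.
by move=> x; rewrite !inE => /orP[]/eqP->.
Qed.

Lemma joined_trans E v u w : joined E u v -> joined E v w -> joined E u w.
Proof.
move=> [q [uq <- Eq]] [q' [vq' <- Eq']]; exists (q ++ q'); split.
- by rewrite cat_path uq vq'.
- by rewrite last_cat.
- move=> x; rewrite -cat_cons mem_cat => /orP[/Eq//|xq'].
  by apply: Eq'; rewrite inE xq' orbT.
Qed.

Lemma joined_sym E u v : joined E u v -> joined E v u.
Proof.
move=> [q [uq <- Eq]]; exists (rev (belast u q)); split.
- by rewrite rev_path; rewrite (eq_path (e' := adj))// => ? ?; rewrite adj_sym.
- by case: q {uq Eq} => //= y q; rewrite rev_cons last_rcons.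
- move=> x; rewrite inE mem_rev => /orP[/eqP->|/mem_belast]; last exact: Eq.
  by apply: Eq; exact: mem_last.
Qed.

Lemma joined_sub E E' u v : E `<=` E' -> joined E u v -> joined E' u v.
Proof. by move=> EE' [q [? ? Eq]]; exists q; split=> // x /Eq/EE'. Qed.

Lemma joined_ind E (R : set T) u v :
  (forall x y, adj x y -> E x -> E y -> R x -> R y) ->
  joined E u v -> R u -> R v.
Proof.
move=> step [q [uq <-]]; elim: q u uq => //= y q IH u /andP[uy yq] Eq Ru.
apply: IH => // [x xq|]; first by apply: Eq; rewrite inE xq orbT.
by apply: step uy _ _ Ru; apply: Eq; rewrite !inE eqxx ?orbT.
Qed.

Lemma joined_aut (x : treeAut T) E u v :
  joined E u v -> joined (x @` E) (x u) (x v).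
Proof.
move=> [q [uq <- Eq]]; exists (map x q); split.
- by rewrite path_map; rewrite (eq_path (e' := adj))// => ? ? /=; rewrite aut_adj.
- by rewrite last_map.
- by move=> y; rewrite -map_cons => /mapP[z /Eq Ez ->]; exists z.
Qed.

(** Two different neighbours of v joined without passing through v would close
    a circuit at v. *)
Lemma neighbour_towards v w1 w2 : adj v w1 -> adj v w2 ->
  joined (fun x => x <> v) w1 w2 -> w1 = w2.
Proof.
move=> vw1 vw2 [q [w1q eq Eq]]; case/shortenP: w1q eq => q' w1q' uq' sub lastq'.
case: q' => [//|y q'] in w1q' uq' sub lastq' *.
case: (@tree_acyclic _ T [:: v, w1, y & q']) => //.
have vq : v \notin [:: w1, y & q'].
  apply/negP => /= vin; apply: (Eq v) => //.
  by move: vin; rewrite in_cons => /orP[/eqP->|/sub vq]; rewrite inE ?eqxx// vq orbT.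
rewrite /ucycle /cycle /= in w1q' uq' *; move: lastq' w1q' => /= lastq'.
by rewrite rcons_path lastq' vw1 (adj_sym w2) vw2 => /andP[-> ->]; rewrite -cons_uniq/= vq.
Qed.

(** Absence of backtracking; unlike the absence of repetitions, this is a
    local property, hence preserved by locally injective maps. *)
Fixpoint reduced q := match q with
  | x :: ((_ :: z :: _) as q') => (x != z) && reduced q'
  | _ => true
  end.

Lemma uniq_reduced q : uniq q -> reduced q.
Proof.
elim: q => // x [//|y [//|z q]] IH /andP[xq uq].
apply/andP; split; last exact: IH.
by move: xq; rewrite !inE !negb_or => /and3P[].
Qed.

(** A first repetition along a path without backtracking would bound a
    circuit. *)
Lemma reduced_uniq u q : path adj u q -> reduced (u :: q) -> uniq (u :: q).
Proof.
elim: q u => // y q IH u /andP[uy +] red; rewrite -/(path adj y q) => yq.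
have redy : reduced (y :: q) by case: q {IH yq} red => // z q /andP[].
have uyq := IH y yq redy; rewrite cons_uniq uyq andbT.
rewrite inE negb_or; apply/andP; split; first exact/eqP/adj_neq.
apply/negP => uq; case/splitPr: uq => q1 q2 in yq uyq red redy IH *.
have [uq1 uniq1] : u \notin y :: q1 /\ uniq (y :: q1).
  move: uyq; rewrite -cat_cons cat_uniq.
  by move=> /and3P[-> /hasPn/(_ u) + _]; rewrite inE eqxx => /(_ isT).
case: q1 => [|z q1] in yq uyq red redy uq1 uniq1 IH *; first by rewrite /= eqxx in red.
apply: (@tree_acyclic _ T [:: u, y, z & q1]) => //.
rewrite /ucycle cons_uniq uq1 uniq1 andbT.
move: yq; rewrite cat_path => /andP[yq /andP[yu _]].
have : path adj u (rcons [:: y, z & q1] u) by rewrite rcons_path yu andbT; apply/andP.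
by move=> cyc; rewrite andbT; exact: cyc.
Qed.

End Trees.

(** * Automorphisms from local data *)

Section LocalPermutations.
Context {d : nat} {T : regularTree d} (c : colouring T).

Lemma aut_nbr (x : treeAut T) v i : x (nbr c v i) = nbr c (x v) (sigma c x v i).
Proof. by rewrite sigmaE nbrK// aut_adj; exact: adj_nbr. Qed.

(** All automorphisms below are built from local data with this lemma. Such a
    map is a covering of a tree by itself: it is injective because it sends
    simple paths to paths without backtracking, and surjective because it
    lifts paths. *)
Lemma aut_of_local (x : T -> T) (s : T -> 'S_d) :
  (forall v i, x (nbr c v i) = nbr c (x v) (s v i)) ->
  exists2 y : treeAut T, y =1 x & forall v, sigma c y v = s v.
Proof.
move=> xnbr.
have xadj u v : adj u v -> adj (x u) (x v).
  by move=> uv; rewrite -(nbrK c uv) xnbr; exact: adj_nbr.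
have xpath u q : path adj u q -> path adj (x u) (map x q).
  by elim: q u => //= y q IH u /andP[/xadj-> /IH->].
have xloc u v w : adj v u -> adj v w -> x u = x w -> u = w.
  move=> vu vw; rewrite -(nbrK c vu) -(nbrK c vw) !xnbr.
  by move=> /nbr_inj/perm_inj->.
have xred u q : path adj u q -> reduced (u :: q) -> reduced (map x (u :: q)).
  elim: q u => // y q IH u /= /andP[uy yq]; case: q => [//|z q] in IH yq *.
  move=> /andP[uz red].
  apply/andP; split; last exact: IH.
  apply: contra uz => /eqP xuz; apply/eqP/(xloc _ y) => //.
    by rewrite adj_sym.
  by case/andP: yq.
have xinj : injective x.
  move=> u v xuv; have [q uq lastq] := tree_connected u v.
  case/shortenP: uq lastq => q' uq' unq _ lastq'.
  have := reduced_uniq (xpath _ _ uq') (xred _ _ uq' (uniq_reduced unq)).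
  case: q' => [//|y q'] in uq' unq lastq' *.
  rewrite cons_uniq => /andP[/negP[]]; rewrite xuv -lastq' -last_map.
  exact: (mem_last (x y) (map x q')).
have xsurj w : exists v, x v = w.
  have [u _] := tree_nonempty T; have [q uq <-] := tree_connected (x u) w.
  elim: q u uq => [u _|y q IH u /= /andP[uy yq]]; first by exists u.
  have xy : y = x (nbr c u ((s u)^-1%g (c (x u) y))) by rewrite xnbr permKV nbrK.
  by rewrite xy in yq *; exact: IH.
have [x' x'K] := choice xsurj.
have xadjE u v : adj (x u) (x v) = adj u v.
  apply/idP/idP => [xuv|/xadj//].
  suff -> : v = nbr c u ((s u)^-1%g (c (x u) (x v))) by exact: adj_nbr.
  by apply: xinj; rewrite xnbr permKV nbrK.
exists (@Defs.Aut _ _ x (Bijective (fun u => xinj _ _ (x'K (x u))) x'K) xadjE) => // v.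
by apply/permP => i; rewrite sigmaE/= xnbr col_nbr.
Qed.

End LocalPermutations.

Lemma min_nat_mem (A : set nat) n : A n -> A (min_nat A).
Proof. by move=> An; have [] := min_natP (ex_intro A n An). Qed.

Lemma min_nat_le (A : set nat) n : A n -> min_nat A <= n.
Proof. by move=> An; have [_] := min_natP (ex_intro A n An); apply. Qed.

(** * Coordinates relative to a line *)

(** A bi-infinite path; the axis of g carries such a structure, and the
    vertices of the tree are located relative to it. *)
Record line (d : nat) (T : regularTree d) := Line {
  line_fun :> int -> T ;
  line_inj : injective line_fun ;
  line_adj : forall i, adj (line_fun i) (line_fun (i + 1)%R)
}.

Section AxisCoordinates.
Context {d : nat} {T : regularTree d} (p : line T).
Let p_inj : injective p. Proof. exact: line_inj. Qed.
Let p_adj i : adj (p i) (p (i + 1)%R). Proof. exact: line_adj. Qed.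
Implicit Types (u v w : T) (i j k : int).

Fixpoint reach n v : Prop := match n with
  | 0 => exists i, v = p i
  | n'.+1 => exists2 w, adj v w & reach n' w
  end.

Definition height v := min_nat [set n | reach n v].

Definition parent v : T := xget v [set w | adj v w /\ (height w).+1 = height v].

Definition level v : int := xget 0%R [set i | p i = iter (height v) parent v].

Lemma reach_path v q i : path adj v q -> last v q = p i -> reach (size q) v.
Proof.
elim: q v => [|y q IH] v /=; first by exists i.
by move=> /andP[vy yq] lastq; exists y => //; exact: IH.
Qed.

Lemma height_reach v : reach (height v) v.
Proof.
have [q vq lastq] := tree_connected v (p 0%R).
exact: (@min_nat_mem [set n | reach n v] _ (reach_path vq lastq)).
Qed.

Lemma height_min n v : reach n v -> height v <= n.
Proof. exact: min_nat_le. Qed.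

Lemma height_p i : height (p i) = 0.
Proof. by apply/eqP; rewrite -leqn0; apply: height_min; exists i. Qed.

Lemma height_eq0 v : height v = 0 -> exists i, v = p i.
Proof. by move=> h0; have := height_reach v; rewrite h0. Qed.

Lemma height_adj v w : adj v w -> height v <= (height w).+1.
Proof. by move=> vw; apply: height_min; exists w => //; exact: height_reach. Qed.

Lemma parentP v : 0 < height v ->
  adj v (parent v) /\ (height (parent v)).+1 = height v.
Proof.
case hv : (height v) => [//|n] _.
have := height_reach v; rewrite hv => -[w vw rw].
have hw : (height w).+1 = height v.
  by apply/eqP; rewrite eqn_leq height_adj// hv ltnS height_min.
have := @xgetPex _ v [set w | adj v w /\ (height w).+1 = height v].
by rewrite -hv; apply; exists w.
Qed.

Lemma height_parent v : 0 < height v -> height (parent v) = (height v).-1.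
Proof. by move=> /parentP[_ <-]. Qed.

Lemma parent_p i : parent (p i) = p i.
Proof.
rewrite /parent; case: xgetP => // w -> [_].
by rewrite height_p.
Qed.

Lemma axis_joined (E : set T) i (n : nat) :
  (forall k, (i <= k <= i + n%:Z)%R -> E (p k)) -> joined E (p i) (p (i + n%:Z)%R).
Proof.
elim: n => [|n IH] Ep.
  by rewrite addr0; apply: joined_refl; apply: Ep; lia.
apply: (joined_trans (IH _)) => [k ?|]; first by apply: Ep; lia.
rewrite (_ : i + n.+1%:Z = i + n%:Z + 1)%R; last by lia.
by apply: joined_step => //; apply: Ep; lia.
Qed.

Lemma axis_connected i j : joined (range p) (p i) (p j).
Proof.
wlog ij : i j / (i <= j)%R.
  by move=> wl; have [/wl//|ji] := lerP i j; apply/joined_sym/wl/ltW.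
rewrite (_ : j = i + (absz (j - i)%R)%:Z)%R; last by lia.
by apply: axis_joined => k _; exists k.
Qed.

Lemma descend v : exists i,
  joined (fun x => x = v \/ height x < height v) v (p i).
Proof.
have [n] := ubnP (height v); elim: n v => // n IH v.
have [h0 _|h0 lt] := posnP (height v).
  have [i vi] := height_eq0 h0; exists i; rewrite -vi.
  by apply: joined_refl; left.
have [vp hp] := parentP h0.
have [|i pi] := IH (parent v); first by rewrite height_parent; lia.
exists i; apply: joined_trans (joined_step vp _ _) (joined_sub _ pi).
- by left.
- by right; lia.
- by move=> x [->|hx]; right; lia.
Qed.

(** Two neighbours of v that are no higher than v both descend to the line
    without meeting v again. *)
Lemma parent_uniq v w : adj v w -> height w <= height v -> 0 < height v ->
  w = parent v.
Proof.
move=> vw hw h0; have [vp hp] := parentP h0.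
suff to_axis u : adj v u -> height u <= height v -> exists i,
    joined (fun x => x <> v) u (p i).
  have [i wi] := to_axis w vw hw.
  have [|j pj] := to_axis (parent v) vp; first by lia.
  apply: (neighbour_towards vw vp); apply: joined_trans wi _.
  apply: joined_trans (joined_sym pj).
  by apply: joined_sub (axis_connected i j) => _ [k _ <-] e; rewrite -e height_p in h0.
move=> vu hu; have [i ui] := descend u; exists i.
apply: joined_sub ui => x [->|hx] e; first by apply: (adj_neq vu).
by rewrite e ltnNge hu in hx.
Qed.

Lemma axis_next i j : (i < j)%R -> adj (p i) (p j) -> j = (i + 1)%R.
Proof.
move=> ij pij; apply: p_inj; apply/esym.
apply: (neighbour_towards (p_adj i) pij).
rewrite (_ : j = i + 1 + (absz (j - i - 1)%R)%:Z)%R; last by lia.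
by apply: axis_joined => k ? /p_inj; lia.
Qed.

Lemma axis_adj i j : adj (p i) (p j) -> j = (i + 1)%R \/ i = (j + 1)%R.
Proof.
case: (ltgtP i j) => [ij /axis_next -> //|ji|->]; [by left| |by rewrite adj_irr].
by rewrite adj_sym => /axis_next->//; right.
Qed.

(** The whole shape of the tree relative to the line: an edge either joins a
    vertex to its parent or lies on the line. *)
Lemma adjP v w : adj v w ->
  [\/ 0 < height v /\ w = parent v, 0 < height w /\ v = parent w,
      exists i, v = p i /\ w = p (i + 1)%R
    | exists i, v = p (i + 1)%R /\ w = p i].
Proof.
move=> vw; have [hw|hv] := leqP (height w) (height v).
  have [h0|h0] := posnP (height v); last first.
    by apply: Or41; split=> //; exact: parent_uniq.
  have w0 : height w = 0 by lia.
  have [i vi] := height_eq0 h0; have [j wj] := height_eq0 w0.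
  move: vw; rewrite vi wj => /axis_adj[->|->]; first by apply: Or43; exists i.
  by apply: Or44; exists j.
apply: Or42; split; first by lia.
by apply: parent_uniq; [rewrite adj_sym|lia|lia].
Qed.

Lemma iter_parent v : exists i, p i = iter (height v) parent v.
Proof.
have [n hn] := ubnP (height v); elim: n v hn => // n IH v.
case hv : (height v) => [|m] lt; first by have [i] := height_eq0 hv; exists i.
have hp : height (parent v) = m by rewrite height_parent hv.
have [|i pi] := IH (parent v); first by lia.
by exists i; rewrite pi hp iterSr.
Qed.

Lemma p_level v : p (level v) = iter (height v) parent v.
Proof. exact: (xgetPex 0%R (iter_parent v)). Qed.

Lemma level_p i : level (p i) = i.
Proof. by apply: p_inj; rewrite p_level height_p. Qed.

Lemma height0_p v : height v = 0 -> v = p (level v).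
Proof. by move=> h0; rewrite p_level h0. Qed.

Lemma level_parent v : level (parent v) = level v.
Proof.
have [h0|h0] := posnP (height v).
  by have [i ->] := height_eq0 h0; rewrite parent_p.
apply: p_inj; rewrite !p_level height_parent//.
by rewrite -{2}(prednK h0) iterSr.
Qed.

Lemma level_adj v w : adj v w -> level v <> level w ->
  [/\ v = p (level v), w = p (level w) &
      level w = (level v + 1)%R \/ level v = (level w + 1)%R].
Proof.
move=> /adjP[[_ ->]|[_ ->]|[i [-> ->]]|[i [-> ->]]]; rewrite ?level_parent// !level_p.
  by split=> //; left.
by split=> //; right.
Qed.

(** The only edge between the levels up to i and the levels above i lies on
    the line. *)
Lemma level_cross i v w : adj v w -> (level v <= i)%R -> (i < level w)%R ->
  v = p i /\ w = p (i + 1)%R.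
Proof.
move=> vw vi iw; have [|ev ew le] := level_adj vw; first by lia.
by rewrite ev ew; split; congr (p _); lia.
Qed.

(** The vertices of the line nearest to v are all reached by climbing down
    parents, so there is only one. *)
Lemma nearest_unique v q i : path adj v q -> last v q = p i ->
  size q = height v -> i = level v.
Proof.
elim: q v => [|y q IH] v /=; first by move=> _ -> _; rewrite level_p.
move=> /andP[vy yq] lastq sz.
have hy : height y <= size q := height_min (reach_path yq lastq).
have hv := height_adj vy.
have -> := IH y yq lastq; last by lia.
have e : y = parent v by apply: parent_uniq; lia.
by rewrite e level_parent.
Qed.

Lemma path_to_axis v : exists q,
  [/\ path adj v q, last v q = p (level v) & size q = height v].
Proof.
have [n] := ubnP (height v); elim: n v => // n IH v lt.
have [h0|h0] := posnP (height v).
  by exists [::]; rewrite /= h0; split=> //; exact: height0_p.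
have hp := height_parent h0; have [vp _] := parentP h0.
have [|q [pq lastq sz]] := IH (parent v); first by lia.
exists (parent v :: q); split; rewrite /= ?vp ?lastq ?level_parent//.
by rewrite sz hp prednK.
Qed.

Lemma dist_path u v q : path adj u q -> last u q = v -> dist u v <= size q.
Proof.
by move=> uq lastq; apply: min_nat_le; exists q.
Qed.

Lemma distP u v : exists q, [/\ path adj u q, last u q = v & size q = dist u v].
Proof.
have [q uq lastq] := tree_connected u v.
apply: (@min_nat_mem [set n | exists q, [/\ path adj u q, last u q = v & size q = n]] (size q)).
by exists q.
Qed.

Lemma dist_axis v : dist v (p (level v)) = height v.
Proof.
apply/eqP; rewrite eqn_leq; apply/andP; split.
  by have [q [vq lastq <-]] := path_to_axis v; exact: dist_path.
have [q [vq lastq <-]] := distP v (p (level v)).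
exact: height_min (reach_path vq lastq).
Qed.

Lemma proj_axis v w : (range p) w ->
  (forall u, (range p) u -> dist v w <= dist v u) -> w = p (level v).
Proof.
move=> [i _ <-] min; congr (p _).
have [q [vq lastq sz]] := distP v (p i); apply: (nearest_unique vq lastq).
apply/eqP; rewrite eqn_leq; apply/andP; split.
  by rewrite sz -dist_axis; apply: min; exists (level v).
exact: height_min (reach_path vq lastq).
Qed.

Lemma axis_projE g v : axis g = range p -> axis_proj g v = p (level v).
Proof.
move=> ag; rewrite /axis_proj ag; set A := [set _ | _].
suff Ap : A (p (level v)).
  by have [] := @xgetPex _ v A (ex_intro _ _ Ap); exact: proj_axis.
split; first by exists (level v).
move=> _ [j _ <-]; rewrite dist_axis.
by have [q [vq lastq <-]] := distP v (p j); exact: height_min (reach_path vq lastq).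
Qed.

Lemma joined_half_le i v : (level v <= i)%R ->
  joined (fun x => (level x <= i)%R) (p i) v.
Proof.
move=> vi; apply: (@joined_trans _ _ _ (p (level v))).
  apply: joined_sym; rewrite [X in joined _ _ (p X)](_ : i = level v + (absz (i - level v)%R)%:Z)%R; last by lia.
  by apply: axis_joined => k ?; rewrite level_p; lia.
apply: joined_sym; have [n hn] := ubnP (height v); elim: n v vi hn => // n IH v vi lt.
have [h0|h0] := posnP (height v).
  by rewrite -height0_p//; exact: joined_refl.
have [vp hp] := parentP h0; rewrite -level_parent.
apply: joined_trans (joined_step vp _ _) (IH _ _ _); rewrite ?level_parent//.
by rewrite -ltnS (leq_trans _ lt)// ltnS hp.
Qed.

Lemma joined_half_gt i v : (i < level v)%R ->
  joined (fun x => (i < level x)%R) (p (i + 1)%R) v.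
Proof.
move=> vi; apply: (@joined_trans _ _ _ (p (level v))).
  rewrite [X in joined _ _ (p X)](_ : level v = i + 1 + (absz (level v - i - 1)%R)%:Z)%R; last by lia.
  by apply: axis_joined => k ?; rewrite level_p; lia.
apply: joined_sym; have [n hn] := ubnP (height v); elim: n v vi hn => // n IH v vi lt.
have [h0|h0] := posnP (height v).
  by rewrite -height0_p//; exact: joined_refl.
have [vp hp] := parentP h0; rewrite -level_parent.
apply: joined_trans (joined_step vp _ _) (IH _ _ _); rewrite ?level_parent//.
by rewrite -ltnS (leq_trans _ lt)// ltnS hp.
Qed.

Section FixingAxis.
Variable x : treeAut T.

(** The edge from level i to level i + 1 is fixed, and no other edge leads
    from one side of it to the other. *)
Lemma fix_half i v : x (p i) = p i -> x (p (i + 1)%R) = p (i + 1)%R ->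
  (level (x v) <= i)%R = (level v <= i)%R.
Proof.
move=> xi xi1; have [vi|vi] := lerP (level v) i.
  apply: (joined_ind _ (joined_half_le vi) (R := fun y => level (x y) <= i)%R).
    move=> y y' yy' yi y'i xyi; rewrite leNgt; apply/negP => xy'.
    have xyy' : adj (x y) (x y') by rewrite aut_adj.
    have [_] := level_cross xyy' xyi xy'.
    by rewrite -xi1 => /aut_inj e; move: y'i; rewrite e level_p; lia.
  by rewrite xi level_p.
rewrite leNgt; apply/negbTE/negPn.
apply: (joined_ind _ (joined_half_gt vi) (R := fun y => i < level (x y))%R).
  move=> y y' yy' yi y'i xyi; rewrite ltNge; apply/negP => xy'.
  have xyy' : adj (x y') (x y) by rewrite aut_adj adj_sym.
  have [+ _] := level_cross xyy' xy' xyi.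
  by rewrite -xi => /aut_inj e; move: y'i; rewrite e level_p; lia.
by rewrite xi1 level_p; lia.
Qed.

Lemma height_fix v : x (p (level v)) = p (level v) -> height (x v) <= height v.
Proof.
move=> xv; have [q [vq lastq <-]] := path_to_axis v.
rewrite -(size_map x); apply: height_min; apply: (@reach_path _ _ (level v)).
  by rewrite path_map; rewrite (eq_path (e' := adj))// => ? ? /=; rewrite aut_adj.
by rewrite last_map lastq.
Qed.

(** Each vertex of the segment is the neighbour of its predecessor in the
    direction of the far end. *)
Lemma fix_between i j k : x (p i) = p i -> x (p j) = p j ->
  (i <= k <= j)%R -> x (p k) = p k.
Proof.
move=> xi xj.
suff H n : (i + n%:Z <= j)%R -> x (p (i + n%:Z)%R) = p (i + n%:Z)%R.
  by move=> ?; rewrite (_ : k = i + (absz (k - i)%R)%:Z)%R; [apply: H|]; lia.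
elim: n => [_|n IH ij]; first by rewrite addr0.
set m := (i + n%:Z)%R in IH *.
have -> : (i + n.+1%:Z = m + 1)%R by rewrite /m; lia.
have mj : joined (fun y => y <> p m) (p (m + 1)%R) (p j).
  rewrite (_ : j = m + 1 + (absz (j - m - 1)%R)%:Z)%R; last by lia.
  by apply: axis_joined => k' ? /p_inj; lia.
have xm : x (p m) = p m by apply: IH; lia.
apply: (@neighbour_towards _ _ (p m)) (p_adj m) _.
  by rewrite -{1}xm aut_adj.
have := joined_aut x mj; rewrite xj => xmj.
apply: joined_trans (joined_sub _ xmj) (joined_sym mj) => _ [y yn <-].
by rewrite -{1}xm => /aut_inj.
Qed.

End FixingAxis.

Lemma fixV (x : treeAut T) v : x v = v -> (x^-1)%g v = v.
Proof. by move=> xv; rewrite -{1}xv autK. Qed.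

Lemma fix_level (x : treeAut T) (a e : int) v : (forall i, (a <= i <= e)%R -> x (p i) = p i) ->
  (a < level v < e)%R -> level (x v) = level v /\ height (x v) = height v.
Proof.
move=> xp vae.
have lv : level (x v) = level v.
  have := @fix_half x (level v) v (xp _ _) (xp _ _).
  have := @fix_half x (level v - 1)%R v (xp _ _) (xp _ _).
  by move=> /(_ ltac:(lia) ltac:(lia)) ? /(_ ltac:(lia) ltac:(lia)); lia.
split=> //; apply/eqP; rewrite eqn_leq height_fix/=; last by apply: xp; lia.
rewrite -{1}(autK x v); apply: height_fix; apply: fixV; rewrite lv; apply: xp; lia.
Qed.

End AxisCoordinates.

(** * Translations along a line *)

Section Translation.
Context {d : nat} {T : regularTree d} (p : line T).
Variables (g : treeAut T) (l : nat).
Hypothesis l_gt0 : 0 < l.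
Hypothesis gp : forall i, g (p i) = p (i + l%:Z)%R.
Implicit Types (u v w : T) (i j k : int).
Local Notation height := (height p).
Local Notation parent := (parent p).
Local Notation level := (level p).

Lemma height_translate v : height (g v) = height v.
Proof.
have gVp i : g^-1%g (p i) = p (i - l%:Z)%R.
  by rewrite -[in LHS](subrK l%:Z%R i) -gp autK.
have le (h : treeAut T) m w : (forall i, h (p i) = p (i + m)%R) -> height (h w) <= height w.
  move=> hp; have [q [wq lastq <-]] := path_to_axis p w.
  rewrite -(size_map h); apply: height_min; apply: (@reach_path _ _ p _ _ (level w + m)%R).
    by rewrite path_map; rewrite (eq_path (e' := adj))// => ? ? /=; rewrite aut_adj.
  by rewrite last_map lastq hp.
apply/eqP; rewrite eqn_leq (le _ _ _ gp)/=.
by rewrite -{1}(autK g v); exact: le gVp.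
Qed.

Lemma parent_translate v : parent (g v) = g (parent v).
Proof.
have [h0|h0] := posnP (height v).
  by have [i ->] := height_eq0 h0; rewrite gp !parent_p.
have [vp hp] := parentP h0; apply/esym/parent_uniq => //.
- by rewrite aut_adj.
- by rewrite !height_translate; lia.
- by rewrite height_translate.
Qed.

Lemma level_translate v : level (g v) = (level v + l%:Z)%R.
Proof.
apply: (@line_inj _ _ p); rewrite -gp !p_level// height_translate.
by elim: (height v) => //= n ->; rewrite parent_translate.
Qed.

Lemma level_translateV v : level (g^-1%g v) = (level v - l%:Z)%R.
Proof. by rewrite -{2}(autKV g v) level_translate addrK. Qed.

Lemma height_translateV v : height (g^-1%g v) = height v.
Proof. by rewrite -{2}(autKV g v) height_translate. Qed.

Lemma climb u w : adj u w -> 0 < height u -> w <> parent u ->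
  height w = (height u).+1 /\ u = parent w.
Proof.
move=> uw u0 wp; have [[_ //]|[w0 uE]|[i [uE _]]|[i [uE _]]] := adjP p uw.
- by split=> //; have [_ <-] := parentP w0; rewrite -uE.
- by rewrite uE height_p in u0.
- by rewrite uE height_p in u0.
Qed.

(** A path without backtracking that leaves a vertex off the line otherwise
    than through the parent can only go on upwards. *)
Lemma climb_forever (f : nat -> T) : (forall n, adj (f n) (f n.+1)) ->
  (forall n, f n <> f n.+2) -> 0 < height (f 0) -> f 1 <> parent (f 0) ->
  forall n, height (f n) = height (f 0) + n.
Proof.
move=> fadj fne f0 f1.
have H n : height (f n) = height (f 0) + n /\ f n.+1 <> parent (f n).
  elim: n => [|n [hn fn]]; first by rewrite addn0.
  have h0 : 0 < height (f n) by lia.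
  have [h1 e1] := climb (fadj n) h0 fn.
  by split; [lia|move=> e; apply: (fne n); rewrite e].
by move=> n; case: (H n).
Qed.

(** Any other line translated by g would leave this one for good in at least
    one direction, whereas heights are invariant under g. *)
Lemma axisE : axis g = range p.
Proof.
apply/seteqP; split; last first.
  by move=> _ [i _ <-]; exists p, l; split; [exact: line_inj|exact: line_adj| |exists i].
move=> _ [p' [l' [p'inj p'adj [l'0 gp'] [i _ <-]]]].
suff h0 : height (p' i) = 0 by have [j ->] := height_eq0 h0; exists j.
apply/eqP; rewrite -leqn0 leqNgt; apply/negP => h0.
have up (f : nat -> T) : (forall n, adj (f n) (f n.+1)) ->
    (forall n, f n <> f n.+2) -> f 0 = p' i -> height (f l') = height (p' i) ->
    f 1 <> parent (p' i) -> False.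
  move=> fadj fne f0 fl f1; have := @climb_forever f fadj fne; rewrite f0.
  by move=> /(_ h0 f1 l'); rewrite fl; lia.
have [e|/eqP ne] := eqVneq (p' (i + 1)%R) (parent (p' i)); last first.
  apply: (up (fun n => p' (i + n%:Z)%R)) ne => [n|n /p'inj| |]; rewrite ?addr0//; last first.
  - by rewrite -gp' height_translate.
  - by lia.
  by rewrite (_ : i + n.+1%:Z = i + n%:Z + 1)%R; [|lia].
apply: (up (fun n => p' (i - n%:Z)%R)) => [n|n /p'inj| | |]; rewrite ?subr0//.
- by rewrite adj_sym (_ : i - n%:Z = i - n.+1%:Z + 1)%R; [|lia].
- by lia.
- by rewrite -height_translate gp' subrK.
- by rewrite -e => /p'inj; lia.
Qed.

End Translation.

(** * Local actions of conjugates by large powers *)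

Section EventualLocalAction.
Context {d : nat} {T : regularTree d} (c : colouring T) (F : {group 'S_d}).
Local Open Scope group_scope.
Implicit Types (h x y : treeAut T) (v : T).

Lemma sigmaJ h x v : sigma c (h * x * h^-1) (h v) =
  (sigma c h v)^-1 * sigma c x v * sigma c h (x v).
Proof. by rewrite !sigmaM sigmaV autK mulgA. Qed.

Lemma sigmaJ_mem h x v : sigma c h v \in F -> sigma c h (x v) \in F ->
  (sigma c (h * x * h^-1) (h v) \in F) = (sigma c x v \in F).
Proof. by move=> hv hxv; rewrite sigmaJ groupMr// groupMl// groupV. Qed.

Lemma sigma_fixed x v : x v = v -> (forall w, adj v w -> x w = w) -> sigma c x v = 1.
Proof.
move=> xv xw; apply/permP => i.
by rewrite sigmaE perm1 xv xw ?col_nbr//; exact: adj_nbr.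
Qed.

(** The condition is on the conjugates of x by large powers of h only, so that
    it is invariant under conjugation by h. *)
Definition eventually_F h x v := exists N, forall n, (N <= n)%N ->
  sigma c (h ^+ n * x * (h ^+ n)^-1) ((h ^+ n) v) \in F.

Lemma eventually_FM h x y v : eventually_F h x (y v) -> eventually_F h y v ->
  eventually_F h (x * y) v.
Proof.
move=> [N xF] [M yF]; exists (maxn N M) => n; rewrite geq_max => /andP[Nn Mn].
set k := h ^+ n in xF yF *.
rewrite (_ : k * (x * y) * k^-1 = (k * x * k^-1) * (k * y * k^-1)); last first.
  by rewrite !mulgA mulgKV.
by rewrite sigmaM groupM ?yF// !autME autK xF.
Qed.

Lemma eventually_FV h x v : eventually_F h x (x^-1 v) -> eventually_F h x^-1 v.
Proof.
move=> [N xF]; exists N => n /xF {xF}; set k := h ^+ n => xF.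
rewrite (_ : k * x^-1 * k^-1 = (k * x * k^-1)^-1); last first.
  by rewrite !invMg invgK mulgA.
by rewrite sigmaV groupV !invMg invgK !autME autK.
Qed.

Lemma eventually_FJ h x v :
  eventually_F h (h * x * h^-1) (h v) <-> eventually_F h x v.
Proof.
have E n : h ^+ n * (h * x * h^-1) * (h ^+ n)^-1 = h ^+ n.+1 * x * (h ^+ n.+1)^-1.
  by rewrite expgSr invMg !mulgA.
split=> -[N xF]; exists N.+1; [case=> // n|move=> n] => Nn.
  by have := xF n Nn; rewrite E expgSr.
by rewrite E -autME -expgSr; apply: xF; rewrite ltnW// ltnW.
Qed.

Lemma eventually_F_fixed h x v : x v = v -> sigma c x v = 1 -> eventually_F h x v.
Proof.
by move=> xv sx; exists 0 => n _; rewrite sigmaJ xv sx mulg1 mulVg group1.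
Qed.

Lemma eventually_F_local h x y v : x v = y v -> sigma c x v = sigma c y v ->
  eventually_F h x v -> eventually_F h y v.
Proof.
by move=> e s [N xF]; exists N => n /xF; rewrite !sigmaJ e s.
Qed.

Lemma eventually_F_stable h x v : (forall n, sigma c (h ^+ n) v \in F) ->
  (forall n, sigma c (h ^+ n) (x v) \in F) ->
  eventually_F h x v <-> sigma c x v \in F.
Proof.
move=> hv hxv; split=> [[N /(_ N (leqnn N))]|xF]; first by rewrite sigmaJ_mem.
by exists 0 => n _; rewrite sigmaJ_mem.
Qed.

Lemma eventually_FX h k x v :
  eventually_F h (h ^+ k * x * (h ^+ k)^-1) ((h ^+ k) v) <-> eventually_F h x v.
Proof.
elim: k => [|k IH]; first by rewrite expg0 mul1g invg1 mulg1.
rewrite -IH -[X in _ <-> X]eventually_FJ.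
by rewrite expgS invMg !mulgA autME.
Qed.

End EventualLocalAction.

(** * The minimising groups *)

(** Coordinates adapted to g: a line translated by g, and bounds on the
    position of the singularities of g. The line is numbered so that the
    singularities lie strictly between levels 0 and [frame_end]. *)
Record tubeFrame (d : nat) (T : regularTree d) (c : colouring T)
    (F : {group 'S_d}) (g : treeAut T) := TubeFrame {
  frame_line : line T ;
  frame_shift : nat ;
  frame_end : int ;
  frame_radius : nat ;
  frame_shift_gt0 : 0 < frame_shift ;
  frame_translate : forall i, g (frame_line i) = frame_line (i + frame_shift%:Z)%R ;
  frame_shift_lt : (frame_shift%:Z < frame_end)%R ;
  frame_radius_gt0 : 0 < frame_radius ;
  frame_singularities : singularities c F g `<=`
    [set v | (0 < level frame_line v < frame_end)%R /\
             height frame_line v < frame_radius]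
}.

Section TidyGroups.
Context {d : nat} {T : regularTree d} (c : colouring T) (F : {group 'S_d}).
Context {g : treeAut T} (S : tubeFrame c F g).
Implicit Types (x y : treeAut T) (v w : T) (i j k a e : int).
Local Notation p := (frame_line S).
Local Notation l := (frame_shift S).
Local Notation b := (frame_end S).
Local Notation r := (frame_radius S).
Local Notation height := (height p).
Local Notation parent := (parent p).
Local Notation level := (level p).

Definition tube a e : set T := [set v | (a < level v < e)%R /\ height v < r].

Let l_gt0 : 0 < l. Proof. exact: frame_shift_gt0. Qed.
Let gp i : g (p i) = p (i + l%:Z)%R. Proof. exact: frame_translate. Qed.
Let lb : (l%:Z < b)%R. Proof. exact: frame_shift_lt. Qed.
Let sing : singularities c F g `<=` tube 0%R b. Proof. exact: frame_singularities. Qed.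
Let gh := height_translate gp.
Let gl := level_translate l_gt0 gp.
Let ghV := height_translateV gp.
Let glV := level_translateV l_gt0 gp.

Lemma sigma_notin_tube v : ~ tube 0%R b v -> sigma c g v \in F.
Proof. by move=> nt; apply/negPn/negP => /sing. Qed.

Lemma level_pow n v : level ((g ^+ n)%g v) = (level v + (n * l)%N%:Z)%R.
Proof.
elim: n => [|n IH]; first by rewrite expg0 aut1E mul0n addr0.
by rewrite expgS autME gl IH; lia.
Qed.

Lemma height_pow n v : height ((g ^+ n)%g v) = height v.
Proof. by elim: n => // n IH; rewrite expgS autME gh IH. Qed.

(** Powers of g only move a vertex further away from the singularities of g
    once it is at level [frame_end]. *)
Lemma sigma_pow n v : (b <= level v)%R || (r <= height v) ->
  sigma c (g ^+ n)%g v \in F.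
Proof.
elim: n v => [|n IH] v hv; first by rewrite expg0 sigma1 group1.
rewrite expgSr sigmaM groupM ?IH ?gl ?gh//; last by lia.
by apply: sigma_notin_tube => -[]; lia.
Qed.

(** Level [frame_shift] and not only level 0 is allowed, because the inverse
    of g is singular at the images under g of the singularities of g. *)
Lemma sigma_powV n v : (level v <= l%:Z)%R || (r <= height v) ->
  sigma c (g^-1 ^+ n)%g v \in F.
Proof.
elim: n v => [|n IH] v hv; first by rewrite expg0 sigma1 group1.
rewrite expgSr sigmaM groupM ?IH ?glV ?ghV//; last by lia.
rewrite sigmaV groupV.
by apply: sigma_notin_tube; rewrite /tube /= glV ghV => -[]; lia.
Qed.

(** At high levels the forward half, and at low levels the backward half,
    reduces to the condition that the local action is in F ([eventually_high],
    [eventually_low]); so the two are kept apart. *)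
Definition good x v := eventually_F c F g x v /\ eventually_F c F g^-1%g x v.

Lemma eventually_high x v :
  (b <= level v)%R || (r <= height v) -> (b <= level (x v))%R || (r <= height (x v)) ->
  eventually_F c F g x v <-> sigma c x v \in F.
Proof. by move=> hv hxv; apply: eventually_F_stable => n; exact: sigma_pow. Qed.

Lemma eventually_low x v : (level v <= l%:Z)%R || (r <= height v) ->
  (level (x v) <= l%:Z)%R || (r <= height (x v)) ->
  eventually_F c F g^-1%g x v <-> sigma c x v \in F.
Proof. by move=> hv hxv; apply: eventually_F_stable => n; exact: sigma_powV. Qed.

Lemma goodM x y v : good x (y v) -> good y v -> good (x * y)%g v.
Proof. by move=> [? ?] [? ?]; split; exact: eventually_FM. Qed.

Lemma goodV x v : good x (x^-1%g v) -> good x^-1%g v.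
Proof. by move=> [? ?]; split; exact: eventually_FV. Qed.

Lemma good_fixed x v : x v = v -> sigma c x v = 1%g -> good x v.
Proof. by move=> ? ?; split; exact: eventually_F_fixed. Qed.

Lemma good_local x y v : x v = y v -> sigma c x v = sigma c y v ->
  good x v -> good y v.
Proof. by move=> e s [? ?]; split; apply: eventually_F_local e s _. Qed.

Lemma goodJ x v : good (g * x * g^-1)%g (g v) <-> good x v.
Proof.
rewrite /good eventually_FJ -(eventually_FJ _ _ g^-1%g (g * x * g^-1)%g).
by rewrite invgK -!autME !mulgA mulVg mul1g mulgKV.
Qed.

Definition fixes_line a e x := forall i, (a <= i <= e)%R -> x (p i) = p i.

Lemma fixes_lineV a e x : fixes_line a e x -> fixes_line a e x^-1%g.
Proof. by move=> xp i ie; apply: fixV; exact: xp. Qed.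

Lemma fixes_lineM a e x y : fixes_line a e x -> fixes_line a e y -> fixes_line a e (x * y)%g.
Proof. by move=> xp yp i ie; rewrite autME yp ?xp. Qed.

Lemma tube_fix a e x v : fixes_line a e x -> tube a e (x v) <-> tube a e v.
Proof.
suff H y w : fixes_line a e y -> tube a e w -> tube a e (y w).
  by move=> xp; split; [rewrite -{2}(autK x v)|]; apply: H => //; exact: fixes_lineV.
by move=> yp [aw hw]; rewrite /tube/=; have [-> ->] := fix_level yp aw.
Qed.

(** The enlargement of the stabiliser of a tube that makes its indices
    multiplicative: inside the tube the local action need not be in F, only
    good. *)
Definition tidy a e : set (treeAut T) := [set x | fixes_line a e x /\
  forall v, (tube a e v -> good x v) /\ (~ tube a e v -> sigma c x v \in F)].

Lemma tidy_subgroup a e : subgroup (tidy a e).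
Proof.
split.
  split=> [//|v]; split=> _; last by rewrite sigma1 group1.
  by apply: good_fixed; rewrite ?sigma1.
move=> x y [xp xt] [yp yt]; have yVp := fixes_lineV yp.
split; first exact: fixes_lineM.
move=> v; have tv := tube_fix v yVp; split=> vt.
  have vt' := tv.2 vt.
  by apply: goodM; [apply: (xt _).1|apply: goodV; apply: (yt _).1].
have vt' : ~ tube a e (y^-1%g v) by move=> /tv.
by rewrite sigmaM sigmaV groupM ?groupV; [|apply: (yt _).2|apply: (xt _).2].
Qed.

(** Off the tube g has local actions in F, so conjugation does not affect the
    condition there; in the tube goodness is invariant. *)
Lemma tidyJ a e x : (a <= 0)%R -> (b <= e)%R ->
  tidy (a + l%:Z)%R (e + l%:Z)%R (g * x * g^-1)%g <-> tidy a e x.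
Proof.
move=> a0 be.
have pE : fixes_line (a + l%:Z)%R (e + l%:Z)%R (g * x * g^-1)%g <-> fixes_line a e x.
  have gVp i : g^-1%g (p i) = p (i - l%:Z)%R by rewrite -[in LHS](subrK l%:Z%R i) -gp autK.
  split=> xp i ie.
    have := xp (i + l%:Z)%R ltac:(lia).
    by rewrite !autME gVp addrK -gp => /aut_inj.
  by rewrite !autME gVp xp ?gp ?subrK//; lia.
have tE v : tube (a + l%:Z)%R (e + l%:Z)%R (g v) <-> tube a e v.
  by rewrite /tube /= gl gh; split=> -[? ?]; split=> //; lia.
have sE v : fixes_line a e x -> ~ tube a e v ->
    (sigma c (g * x * g^-1)%g (g v) \in F) = (sigma c x v \in F).
  have out w : ~ tube a e w -> sigma c g w \in F.
    by move=> nw; apply: sigma_notin_tube => -[? ?]; apply: nw; split=> //; lia.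
  by move=> xp nv; apply: sigmaJ_mem; apply: out => // /(tube_fix _ xp).
split=> [[/pE xp xt]|[xp xt]].
  split=> // v; have [t1 t2] := xt (g v); split=> tv.
    by apply/goodJ/t1/tE.
  by rewrite -sE//; apply: t2 => /tE.
split=> [|v]; first exact/pE.
rewrite -(autKV g v); have [t1 t2] := xt (g^-1%g v); split=> [/tE tv|nv].
  exact/goodJ/t1.
have nv' : ~ tube a e (g^-1%g v) by move=> /tE.
by rewrite sE//; exact: t2.
Qed.

(** At levels up to [frame_shift] the backward half of goodness is the
    condition that the local action is in F. *)
Lemma tidy_shrink_left a a' e : (a <= a')%R -> (a' <= l%:Z)%R ->
  tidy a e `<=` tidy a' e.
Proof.
move=> aa' a'l x [xp xt]; split=> [i ?|v]; first by apply: xp; lia.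
split=> [[ve hv]|nv]; first by apply: (xt v).1; split=> //; lia.
have [[ve hv]|n] := pselect (tube a e v); last exact: (xt v).2.
have [lx hx] := fix_level xp ve.
have ? : (level v <= a')%R by rewrite leNgt; apply/negP => v0; apply: nv; split=> //; lia.
have [_ xF] := (xt v).1 (conj ve hv).
by apply/(eventually_low _ _).1: xF; rewrite ?lx; lia.
Qed.

(** At levels from [frame_end] on the forward half of goodness is the
    condition that the local action is in F. *)
Lemma tidy_shrink_right a e e' : (b <= e)%R -> (e <= e')%R ->
  tidy a e' `<=` tidy a e.
Proof.
move=> be ee' x [xp xt]; split=> [i ?|v]; first by apply: xp; lia.
split=> [[ve hv]|nv]; first by apply: (xt v).1; split=> //; lia.
have [[ve hv]|n] := pselect (tube a e' v); last exact: (xt v).2.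
have [lx hx] := fix_level xp ve.
have ? : (b <= level v)%R by rewrite leNgt; apply/negP => v0; apply: nv; split=> //; lia.
have [xF _] := (xt v).1 (conj ve hv).
by apply/(eventually_high _ _).1: xF; rewrite ?lx; lia.
Qed.

Lemma tidy_conj a e : (a <= 0)%R -> (b <= e)%R ->
  conj_set g (tidy a e) = tidy (a + l%:Z)%R (e + l%:Z)%R.
Proof.
move=> a0 be; rewrite conj_setE; apply/seteqP; split=> x /=.
  by rewrite -tidyJ// -!mulgA mulKVg mulgV mulg1.
by move=> xt; apply/tidyJ => //; rewrite -!mulgA mulKVg mulgV mulg1.
Qed.

Lemma tidy_conjX n a e : (a + (n * l)%N%:Z <= l%:Z)%R -> (b <= e)%R ->
  conj_set (g ^+ n)%g (tidy a e) =
  tidy (a + (n * l)%N%:Z)%R (e + (n * l)%N%:Z)%R.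
Proof.
elim: n => [|n IH]; rewrite ?mulSn => al be.
  by rewrite expg0 conj_set1 mul0n !addr0.
have nl0 : (0 <= (n * l)%N%:Z)%R by [].
have [al' be'] : (a + (n * l)%N%:Z <= l%:Z)%R /\ (b <= e + (n * l)%N%:Z)%R by lia.
rewrite expgS conj_setM IH// tidy_conj//; last by lia.
by congr tidy; lia.
Qed.

(** An element of both groups fixes the two ends of a long segment, hence the
    whole segment. At the levels between the two tubes, its local actions and
    those of its conjugate are in F, and these two facts are the two halves of
    goodness there. *)
Lemma tidy_powers n :
  tidy 0%R b `&` conj_set (g^-1 ^+ n)%g (tidy 0%R b) = tidy (- (n * l)%N%:Z)%R b.
Proof.
rewrite conj_setE expgVn invgK; apply/seteqP; split=> x /=; last first.
  move=> xt; split; first by apply: tidy_shrink_left xt => //; rewrite oppr_le0.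
  have : conj_set (g ^+ n)%g (tidy (- (n * l)%N%:Z)%R b) (g ^+ n * x * (g ^+ n)^-1)%g by exists x.
  rewrite tidy_conjX ?addNr//.
  by apply: tidy_shrink_right => //; rewrite lerDl.
set h := (g ^+ n)%g; move=> [[xp xt] [xp' xt']].
have hVp i : h^-1%g (p (i + (n * l)%N%:Z)%R) = p i.
  suff -> : p (i + (n * l)%N%:Z)%R = h (p i) by rewrite autK.
  have h0 : height (h (p i)) = 0 by rewrite height_pow height_p.
  by rewrite [RHS](height0_p h0) level_pow level_p.
have xnl : x (p (- (n * l)%N%:Z)%R) = p (- (n * l)%N%:Z)%R.
  have := xp' 0%R ltac:(lia); rewrite !autME.
  rewrite -[X in h^-1%g (p X)](addNr (n * l)%N%:Z%R) hVp => e.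
  by apply: (@aut_inj _ _ h); rewrite e -(autKV h (p 0%R)) -[X in h^-1%g (p X)](addNr (n * l)%N%:Z%R) hVp.
have xfix : fixes_line (- (n * l)%N%:Z)%R b x.
  by move=> i ib; apply: (fix_between xnl) ib; apply: xp; lia.
split=> // v; split=> [[vb hv]|nv]; last first.
  by apply: (xt v).2 => -[? ?]; apply: nv; split=> //; lia.
have [lx hx] := fix_level xfix vb.
have [v0|v0] := ltrP 0%R (level v); first by apply: (xt v).1; split=> //; lia.
have nt : ~ tube 0%R b v by move=> -[]; lia.
have xF := (xt v).2 nt.
split; last by apply/eventually_low; rewrite ?lx ?v0; lia.
apply/(eventually_FX _ _ _ n); rewrite -/h.
have hxv : (h * x * h^-1)%g (h v) = h (x v) by rewrite !autME autK.
have [/(xt' _).1[]//|nt'] := pselect (tube 0%R b (h v)).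
have bh : (b <= level (h v))%R.
  by rewrite leNgt; apply/negP => v1; apply: nt'; split; rewrite ?height_pow ?level_pow in v1 *; lia.
apply/eventually_high; first by rewrite bh.
  by rewrite hxv level_pow lx -level_pow bh.
exact: (xt' _).2.
Qed.

Lemma tidy_conjI :
  conj_set g (tidy 0%R b) `&` tidy 0%R b = tidy 0%R (b + l%:Z)%R.
Proof.
have := tidy_powers 1; rewrite expg1 mul1n => /(congr1 (conj_set g)).
rewrite conj_setI -conj_setM mulgV conj_set1 => ->.
by rewrite tidy_conj ?addNr//; lia.
Qed.

(** The first factor agrees with x up to level i and is trivial beyond, the
    second one conversely; the pieces fit because both ends of the only edge
    between the two sides are fixed. This is the independence property of the
    groups U(F), with control of the local actions. *)
Lemma split_at i x : x (p i) = p i -> x (p (i + 1)%R) = p (i + 1)%R ->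
  exists h y, [/\ x = (h * y)%g,
    forall v, (level v <= i)%R ->
      [/\ y v = v, sigma c y v = 1%g, h v = x v & sigma c h v = sigma c x v]
  & forall v, (i < level v)%R ->
      [/\ h v = v, sigma c h v = 1%g, y v = x v & sigma c y v = sigma c x v]].
Proof.
move=> xi xi1.
pose y0 v := if (level v <= i)%R then v else x v.
pose s v : 'S_d := if (level v <= i)%R then 1%g else sigma c x v.
have [|y yE sE] := @aut_of_local _ _ c y0 s.
  move=> v j; rewrite /y0 /s; have vw := adj_nbr c v j.
  case: (lerP (level v)) => vi; case: (lerP (level (nbr c v j))) => wi.
  - by rewrite perm1.
  - by have [-> e] := level_cross vw vi wi; rewrite perm1 e.
  - rewrite adj_sym in vw; have [e ve] := level_cross vw wi vi.
    by rewrite -aut_nbr e xi.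
  - exact: aut_nbr.
have yle v : (level v <= i)%R -> y v = v /\ sigma c y v = 1%g.
  by move=> vi; rewrite yE sE /y0 /s vi.
have ygt v : (i < level v)%R -> y v = x v /\ sigma c y v = sigma c x v.
  by rewrite yE sE /y0 /s leNgt => ->.
exists (x * y^-1)%g, y; split=> [|v vi|v vi]; first by rewrite mulgKV.
  have [yv sy] := yle v vi; split=> //.
    by rewrite autME fixV.
  by rewrite sigmaM sigmaV fixV// sy invg1 mul1g.
have [yv sy] := ygt v vi.
have [xw sxw] : x (y^-1%g v) = v /\ sigma c x (y^-1%g v) = sigma c y (y^-1%g v).
  have [|<- <-] := ygt (y^-1%g v); last by rewrite autKV.
  rewrite ltNge; apply/negP => wi; have [] := yle _ wi.
  by rewrite autKV => e; move: wi; rewrite -e leNgt vi.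
by split=> //; rewrite sigmaM sigmaV sxw mulVg.
Qed.

Definition beyond : set T := [set v | (l%:Z < level v)%R \/ v = p l%:Z%R].

(** The elements supported on the levels up to [frame_shift]: by splitting,
    they represent all the cosets that matter. *)
Definition beyond_fixer := fixer c F beyond.

Lemma fixer_subgroup A : subgroup (fixer c F A).
Proof.
by split=> [|x y xA yA]; [exact: fixer1|apply: fixerM => //; exact: fixerV].
Qed.

Lemma beyond_fixed h v : beyond_fixer h -> (l%:Z < level v)%R ->
  h v = v /\ sigma c h v = 1%g.
Proof.
move=> [_ hh] lv; have hv : h v = v by apply: hh; left.
split=> //; apply: sigma_fixed => // w vw; apply: hh.
have [lw|wl] := ltrP l%:Z%R (level w); [by left|right].
by rewrite adj_sym in vw; have [] := level_cross vw wl lv.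
Qed.

Lemma beyond_fixer_tidy h e : beyond_fixer h -> tidy l%:Z%R e h.
Proof.
move=> hh; split=> [i ie|v].
  apply: hh.2; have [->|/eqP il] := eqVneq i l%:Z%R; [by right|left].
  by rewrite level_p; lia.
split=> [[lv _]|_]; last exact: hh.1.
by have [|? ?] := beyond_fixed (v := v) hh; [lia|exact: good_fixed].
Qed.

(** At the levels where the two tubes differ the element is trivial. *)
Lemma beyond_fixer_tidyE h e : (b <= e)%R -> beyond_fixer h -> tidy 0%R e h <-> tidy 0%R b h.
Proof.
move=> be hh; split; first by apply: tidy_shrink_right => //; lia.
move=> [hp ht]; split=> [i ie|v].
  by have [il|li] := lerP i l%:Z%R; [apply: hp|apply: (beyond_fixer_tidy e hh).1]; lia.
have [vl|lv] := lerP (level v) l%:Z%R; last first.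
  have [hv sv] := beyond_fixed hh lv.
  by rewrite sv; split=> _; [exact: good_fixed|exact: group1].
split=> [[ve hv]|nv]; first by apply: (ht v).1; split=> //; lia.
by apply: (ht v).2 => -[vb hv]; apply: nv; split=> //; lia.
Qed.

Lemma tidy_split e x : (b <= e)%R -> tidy l%:Z%R e x ->
  exists h y, [/\ x = (h * y)%g, beyond_fixer h & tidy 0%R e y].
Proof.
move=> be [xp xt].
have [||h [y [xE lo hi]]] := @split_at l%:Z%R x; try (apply: xp; lia).
exists h, y; split=> //.
  split=> [v|v [/hi[]//|->]]; last first.
    by have [_ _ -> _] := lo (p l%:Z%R) ltac:(by rewrite level_p); rewrite xp//; lia.
  have [vl|/hi[_ -> _ _]//] := lerP (level v) l%:Z%R.
  have [_ _ _ ->] := lo v vl; apply: (xt v).2 => -[]; lia.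
split=> [i ie|v].
  have [il|li] := lerP i l%:Z%R; first by have [] := lo (p i) ltac:(by rewrite level_p).
  have [_ _ -> _] := hi (p i) ltac:(by rewrite level_p).
  by apply: xp; lia.
have [/lo[yv sy _ _]|lv] := lerP (level v) l%:Z%R.
  by rewrite sy; split=> _; [exact: good_fixed|exact: group1].
have [_ _ yv sy] := hi v lv; rewrite sy; split=> [[ve hv]|nv].
  apply: (good_local (esym yv) (esym sy)); apply: (xt v).1; split=> //; lia.
by apply: (xt v).2 => -[ve hv]; apply: nv; split=> //; lia.
Qed.

Local Notation beyond_fixer0 := (beyond_fixer `&` tidy 0%R b).

(** The index does not depend on e: this is why the indices along the powers
    of g multiply. *)
Lemma transversal_tidy e (I : finType) (t : I -> treeAut T) : (b <= e)%R ->
  left_transversal beyond_fixer beyond_fixer0 t ->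
  left_transversal (tidy l%:Z%R e) (tidy 0%R e) t.
Proof.
move=> be [[tH tinj] tcov]; split; [split=> [i|i j tij]|move=> x xt].
- exact: beyond_fixer_tidy.
- apply: tinj; have hij : beyond_fixer ((t i)^-1 * t j)%g := subgroupVM (fixer_subgroup beyond) (tH i) (tH j).
  by split=> //; exact: (beyond_fixer_tidyE be hij).1.
have [h [y [-> hh yt]]] := tidy_split be xt; have [i [hi ti]] := tcov h hh; exists i.
rewrite mulgA; apply: (subgroupM (tidy_subgroup _ _)) => //.
exact: (beyond_fixer_tidyE be hi).2.
Qed.

Lemma transversal_beyond_fixer e (I : finType) (u : I -> treeAut T) : (b <= e)%R ->
  left_transversal (tidy l%:Z%R e) (tidy 0%R e) u ->
  exists t, left_transversal beyond_fixer beyond_fixer0 (t : I -> treeAut T).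
Proof.
move=> be [[uV uinj] ucov].
have sV := tidy_subgroup 0%R e.
have [t tP] := choice (fun i : I => tidy_split be (uV i)).
have tu (i : I) : tidy 0%R e ((t i)^-1 * u i)%g.
  by have [y [-> _ yt]] := tP i; rewrite mulKg.
have tH (i : I) : beyond_fixer (t i) by have [y []] := tP i.
exists t; split; [split=> // i j [_ tij]|move=> x xh].
  have hij : beyond_fixer ((t i)^-1 * t j)%g := subgroupVM (fixer_subgroup beyond) (tH i) (tH j).
  have tij' := (beyond_fixer_tidyE be hij).2 tij.
  apply: uinj; have := subgroupM sV (subgroupM sV (subgroupV sV (tu i)) tij') (tu j).
  by rewrite invMg invgK !mulgA !mulgK.
have [i ui] := ucov x (beyond_fixer_tidy e xh); exists i.
have hix : beyond_fixer ((t i)^-1 * x)%g := subgroupVM (fixer_subgroup beyond) (tH i) xh.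
split=> //; apply/(beyond_fixer_tidyE be hix).
have := subgroupM sV (tu i) ui.
by rewrite !mulgA mulgK.
Qed.

Lemma transversal_fixer (A B : set T) (I : finType) (t : I -> treeAut T) :
  A `<=` beyond -> A (p l%:Z%R) -> A (p (l%:Z + 1)%R) ->
  (forall v, B v -> (level v <= l%:Z)%R) ->
  left_transversal beyond_fixer (fixer c F (beyond `|` B)) t ->
  left_transversal (fixer c F A) (fixer c F (A `|` B)) t.
Proof.
move=> Ah Al Al1 Bl [[tH tinj] tcov].
split; [split=> [i|i j [tF tAB]]|move=> x [xF xA]].
- exact: fixerS (tH i).
- apply: tinj; have [hF hh] : beyond_fixer ((t i)^-1 * t j)%g := subgroupVM (fixer_subgroup beyond) (tH i) (tH j).
  by split=> // v [/hh//|Bv]; apply: tAB; right.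
have [||h [y [xE lo hi]]] := @split_at l%:Z%R x; try exact: xA.
have hh : beyond_fixer h.
  split=> [v|v [/hi[]//|->]]; last first.
    by have [_ _ -> _] := lo (p l%:Z%R) ltac:(by rewrite level_p); rewrite xA.
  have [/lo[_ _ _ ->]|/hi[_ -> _ _]//] := lerP (level v) l%:Z%R.
  exact: xF.
have [i ti] := tcov h hh; exists i; rewrite xE mulgA; apply: fixerM.
  by apply: fixerS ti => v [/Ah|]; [left|right].
split=> [v|v].
  have [/lo[_ -> _ _]|/hi[_ _ _ ->]] := lerP (level v) l%:Z%R; first exact: group1.
  exact: xF.
have [/lo[//]|lv] := lerP (level v) l%:Z%R.
by case=> [/xA|/Bl]; [have [_ _ -> _] := hi v lv|lia].
Qed.

(** Each step of the chain V(0,b), V(-l,b), V(-2l,b), ... is conjugate under a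
    power of g to the inclusion of V(0,e) in V(l,e) for some e. *)
Lemma separated_powers n (I : finType) (t : I -> treeAut T) :
  left_transversal beyond_fixer beyond_fixer0 t ->
  exists (K : finType) (w : K -> treeAut T), #|K| = (#|I| ^ n)%N /\
    left_separated (tidy 0%R b) (tidy 0%R b `&` conj_set (g^-1 ^+ n)%g (tidy 0%R b)) w.
Proof.
move=> tP; elim: n => [|n [K [w [cK wsep]]]].
  exists unit, (fun=> 1%g); rewrite card_unit expn0; split=> //.
  by split=> [_|[] []//]; exact: subgroup1 (tidy_subgroup _ _).
rewrite !tidy_powers in wsep *.
have nl0 (k : nat) : (0 <= (k * l)%N%:Z)%R by [].
have be : (b <= b + (n.+1 * l)%N%:Z)%R by have := nl0 n.+1; lia.
have [/(@separated_conj _ (g^-1 ^+ n.+1)%g) + _] := transversal_tidy be tP.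
have e1 : conj_set (g^-1 ^+ n.+1)%g (tidy l%:Z%R (b + (n.+1 * l)%N%:Z)%R) =
    tidy (- (n * l)%N%:Z)%R b.
  rewrite (_ : l%:Z = - (n * l)%N%:Z + (n.+1 * l)%N%:Z)%R; last by rewrite mulSn; lia.
  rewrite -tidy_conjX//; last by rewrite mulSn; lia.
  by rewrite -conj_setM expgVn mulVg conj_set1.
have e2 : conj_set (g^-1 ^+ n.+1)%g (tidy 0%R (b + (n.+1 * l)%N%:Z)%R) =
    tidy (- (n.+1 * l)%N%:Z)%R b.
  rewrite -(addNr (n.+1 * l)%N%:Z%R) -tidy_conjX//; last by rewrite addNr; lia.
  by rewrite -conj_setM expgVn mulVg conj_set1.
rewrite e1 e2 => usep.
exists (K * I)%type; eexists; split; first by rewrite card_prod cK -expnSr.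
apply: separatedM wsep usep; try exact: tidy_subgroup.
  by rewrite -tidy_powers; exact: subIsetl.
by apply: tidy_shrink_left; rewrite ?mulSn; have := nl0 n; lia.
Qed.
End TidyGroups.

(** * Compactness and the scale *)

Section TidyTopology.
Context {d : nat} {T : regularTree d} (c : colouring T) (F F' : {group 'S_d}).
Variable g : GFF c F F'.
Variable S : tubeFrame c F g.
Hypothesis sFF' : F \subset F'.
Local Notation p := (frame_line S).
Local Notation l := (frame_shift S).
Local Notation b := (frame_end S).
Local Notation V := (tidy S 0%R b).
Hypothesis tube_fin : finite_set (tube S 0%R b).
Local Notation lift A := [set x : GFF c F F' | A (GFF_aut x)].

Lemma lift_subgroup A : subgroup A -> subgroup (lift A).
Proof.
move=> sA; split=> [|x y Ax Ay]; first exact: subgroup1 sA.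
by have := sA.2 _ _ Ax Ay; rewrite -GFFV -GFFM.
Qed.

Lemma conj_set_lift (h : GFF c F F') A :
  conj_set h (lift A) = lift (conj_set (GFF_aut h) A).
Proof.
rewrite !conj_setE; apply/funext => x.
by rewrite /mkset !GFFM GFFV.
Qed.

Lemma left_separated_lift A B (I : finType) (t : I -> treeAut T) :
  (forall i, GFF_pred c F F' (t i)) -> left_separated A B t ->
  exists t' : I -> GFF c F F', (forall i, GFF_aut (t' i) = t i) /\
    left_separated (lift A) (lift B) t'.
Proof.
by move=> tG [tA tinj]; exists (fun i => MkGFF (tG i)); split.
Qed.

Lemma sigma_GFF (h : GFF c F F') v : sigma c (GFF_aut h) v \in F'.
Proof. by case: h => h /= /asboolP[hF _]; exact: hF. Qed.

(** Conjugation by g preserves U(F'), so that goodness forces the local action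
    into F'. *)
Lemma tidy_GFF x : V x -> GFF_pred c F F' x.
Proof.
move=> [xp xt]; apply/asboolP; split=> [v|]; last first.
  by apply: sub_finite_set tube_fin => v /negP sv; have [//|/(xt v).2] := pselect (tube S 0%R b v).
have [/(xt v).1[[N xF] _]|/(xt v).2] := pselect (tube S 0%R b v); last first.
  exact: (fintype.subsetP sFF' _).
have hF w : sigma c (GFF_aut g ^+ N)%g w \in F'.
  elim: N w {xF} => [|N IH] w; first by rewrite expg0 sigma1 group1.
  by rewrite expgS sigmaM; apply: groupM; [exact: IH|exact: sigma_GFF].
have /(fintype.subsetP sFF') := xF N (leqnn N).
rewrite sigmaJ (groupMr _ (hF _)) groupMl //.
by rewrite groupV; exact: hF.
Qed.

(** An element close to 1 fixes the vertices of the tube and all their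
    neighbours. *)
Lemma tidy_open : open (lift V).
Proof.
pose A : set T := (fun n : nat => p n%:Z%R) @` `I_(absz b).+1 `|`
  (tube S 0%R b `|` \bigcup_(i in [set: 'I_d]) ((fun v => nbr c v i) @` tube S 0%R b)).
have finA : finite_set A.
  rewrite !finite_setU; split; first exact: finite_image.
  by split=> //; apply: bigcup_finite => // i _; exact: finite_image.
rewrite openE => x Vx; exists A => // h; rewrite GFFM GFFV => -[kF kA].
set k := ((GFF_aut x)^-1 * GFF_aut h)%g in kF kA.
have hE : GFF_aut h = (GFF_aut x * k)%g by rewrite /k mulKVg.
rewrite /mkset hE.
apply: (subgroupM (tidy_subgroup _ _ _)) => //; split=> [i ib|v]; last first.
  split=> [tv|_]; last exact: kF.
  have kv : k v = v by apply: kA; right; left.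
  apply: good_fixed => //; apply: sigma_fixed => // w vw; apply: kA; right; right.
  by exists (c v w) => //; exists v => //; rewrite nbrK.
by apply: kA; left; exists (absz i); [rewrite /=; lia|congr (p _); lia].
Qed.

(** An ultrafilter decides every finite partition. *)
Lemma ultra_finite (X : Type) (U : set_system X) (I : finType) (f : X -> I) :
  UltraFilter U -> exists i, U [set x | f x = i].
Proof.
move=> UU; apply: contrapT => no.
have : \forall x \near U, forall i, f x <> i.
  apply: filter_forall => i.
  have [Ui|//] := in_ultra_setVsetC [set x | f x = i] UU.
  by exfalso; apply: no; exists i.
by move=> /filter_ex[x /(_ (f x))].
Qed.

(** Along an ultrafilter, the image of a vertex and the local action there are
    eventually constant: for p_0 the image is fixed, and images and local
    actions at a vertex determine the images of its neighbours. The limits are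
    the local data of an automorphism, which inherits all the defining
    conditions since each involves one vertex only. *)
Lemma tidy_compact : compact (lift V).
Proof.
rewrite compact_ultra => U UU UV.
pose same v w (s : 'S_d) := [set x : GFF c F F' | x v = w /\ sigma c x v = s].
have decide_sigma v w : U [set x : GFF c F F' | x v = w] -> exists s, U (same v w s).
  move=> Uv; have [s Us] := ultra_finite (fun x : GFF c F F' => sigma c x v) UU.
  by exists s; apply: filterS (filterI Uv Us) => x [].
have decide v : exists ws, U (same v ws.1 ws.2).
  suff [w /decide_sigma[s Us]] : exists w, U [set x : GFF c F F' | x v = w].
    by exists (w, s).
  have [q uq lastq] := tree_connected (p 0%R) v.
  apply: (joined_ind (E := setT) (u := p 0%R)
    (R := [set v | exists w, U [set x : GFF c F F' | x v = w]])).
  - move=> u u' uu' _ _ [w /decide_sigma[s Us]]; exists (nbr c w (s (c u u'))).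
    by apply: filterS Us => x [<- <-] /=; rewrite -aut_nbr nbrK.
  - by exists q.
  - exists (p 0%R); apply: filterS UV => x [xp _]; apply: xp.
    by have := frame_shift_lt S; lia.
have [f fE] := choice decide.
have [|y yE sE] := @aut_of_local _ _ c (fun v => (f v).1) (fun v => (f v).2).
  move=> v i; have [x [[<- <-] [<- _]]] := filter_ex (filterI (fE v) (fE (nbr c v i))).
  exact: aut_nbr.
have near_y v : U [set x : GFF c F F' | V x /\ (x v = y v /\ sigma c x v = sigma c y v)].
  by apply: filterS (filterI UV (fE v)) => x; rewrite yE sE.
have Vy : V y.
  split=> [i ib|v].
    by have [x [[xp _] [<- _]]] := filter_ex (near_y (p i)); exact: xp.
  have [x [[_ xt] [xv sx]]] := filter_ex (near_y v); rewrite -sx.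
  split=> [/(xt v).1|/(xt v).2//].
  exact: good_local.
pose y' : GFF c F F' := MkGFF (tidy_GFF Vy); exists y'; split=> // O [A finA AO].
have finB : finite_set (A `|` tube S 0%R b) by rewrite finite_setU.
have big : U (\bigcap_(v in [set` fset_set (A `|` tube S 0%R b)])
    [set x : GFF c F F' | V x /\ (x v = y v /\ sigma c x v = sigma c y v)]).
  by apply: filter_bigI => v _; exact: near_y.
apply: filterS (filterI UV big) => x [Vx xB]; apply: AO.
have {xB}xB v : (A `|` tube S 0%R b) v -> x v = y v /\ sigma c x v = sigma c y v.
  by move=> Bv; have [|_] := xB v; first by rewrite /= in_fset_set// inE.
rewrite GFFM GFFV /=; split=> v; last first.
  by move=> Av; have [xv _] := xB v (or_introl Av); rewrite autME xv autK.
have [_ /(_ v)[_ yx]] := subgroupVM (tidy_subgroup _ _ _) Vy Vx.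
have [tv|/yx//] := pselect (tube S 0%R b v).
have [xv sx] := xB v (or_intror tv).
by rewrite sigmaM sigmaV xv autK sx mulgV group1.
Qed.

Lemma scale_tidy : exists (I : finType) (t : I -> treeAut T),
  left_transversal (beyond_fixer S) (beyond_fixer S `&` V) t /\ scale g = #|I|.
Proof.
have coV : compact_open_subgroup (lift V).
  split; [exact/lift_subgroup/tidy_subgroup|exact: tidy_compact|exact: tidy_open].
have lb := frame_shift_lt S; have l0 := frame_shift_gt0 S.
have cV : conj_set g (lift V) = lift (tidy S l%:Z%R (b + l%:Z)%R).
  by rewrite conj_set_lift tidy_conj ?add0r.
have cVI : conj_set g (lift V) `&` lift V = lift (tidy S 0%R (b + l%:Z)%R).
  by rewrite conj_set_lift -(tidy_conjI S).
have bbl : (b <= b + l%:Z)%R by lia.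
have sV' : subgroup (lift (tidy S 0%R (b + l%:Z)%R)) by exact/lift_subgroup/tidy_subgroup.
have [I [u uP]] : exists (I : finType) (u : I -> GFF c F F'),
    left_transversal (conj_set g (lift V)) (conj_set g (lift V) `&` lift V) u.
  by apply: transversal_of_finite; [rewrite cVI|exact: scale_index_finite].
have [[uV uinj] ucov] := uP; rewrite cVI in uinj ucov; rewrite cV in uV ucov.
have [t tP] : exists t : I -> treeAut T, left_transversal (beyond_fixer S) (beyond_fixer S `&` V) t.
  apply: (transversal_beyond_fixer (u := fun i => GFF_aut (u i)) bbl).
  split; first by split=> // i j uij; apply: uinj; rewrite /mkset GFFM GFFV.
  move=> x xt.
  have : conj_set (GFF_aut g) V x by rewrite tidy_conj ?add0r.
  rewrite conj_setE /= => Vx.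
  pose x' : GFF c F F' := (g * MkGFF (tidy_GFF Vx) * g^-1)%g.
  have x'E : GFF_aut x' = x by rewrite !GFFM GFFV /= -!mulgA mulKVg mulgV mulg1.
  have [|i] := ucov x'; first by rewrite /mkset x'E.
  by rewrite /mkset GFFM GFFV x'E => ?; exists i.
exists I, t; split=> //; apply: (scale_of_tidy coV uP) => n.
have [K [w [cK wsep]]] := separated_powers n tP; exists K.
have [w' [_ w'sep]] := left_separated_lift (fun k => tidy_GFF (wsep.1 k)) wsep.
exists w'; split=> //; rewrite conj_set_lift.
suff -> : GFF_aut (g^-1 ^+ n)%g = ((GFF_aut g)^-1 ^+ n)%g by [].
by elim: n {wsep cK w'sep} => // n IH; rewrite !expgS GFFM IH GFFV.
Qed.

End TidyTopology.

(** * Restriction to the initial segment *)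

Section Block.
Context {d : nat} {T : regularTree d} (c : colouring T) (F : {group 'S_d}).
Context {g : treeAut T} (S : tubeFrame c F g).
Implicit Types (x y : treeAut T) (u v w : T) (i j k : int).
Local Notation p := (frame_line S).
Local Notation l := (frame_shift S).
Local Notation b := (frame_end S).
Local Notation r := (frame_radius S).
Local Notation height := (height p).
Local Notation parent := (parent p).
Local Notation level := (level p).

Let l_gt0 : 0 < l. Proof. exact: frame_shift_gt0. Qed.
Let lb : (l%:Z < b)%R. Proof. exact: frame_shift_lt. Qed.
Let r_gt0 : 0 < r. Proof. exact: frame_radius_gt0. Qed.

(** The vertices of the initial segment apart from its two ends on the axis. *)
Definition block : set T := [set v | (0 < level v <= l%:Z)%R /\ height v <= r].

Definition block_core : set T := [set v | (0 < level v <= l%:Z)%R /\ height v < r].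

(** The identity off the block, as for the automorphisms of a subtree; the two
    ends of the initial segment on the axis are fixed by the elements
    considered. *)
Definition block_restrict (x : T -> T) : T -> T :=
  fun v => if `[< block v >] then x v else v.

Lemma block_restrict_in x v : block v -> block_restrict x v = x v.
Proof. by move=> Bv; rewrite /block_restrict asboolT. Qed.

Lemma block_restrict_out x v : ~ block v -> block_restrict x v = v.
Proof. by move=> Bv; rewrite /block_restrict asboolF. Qed.

Local Notation beyond_fixer0 := (beyond_fixer S `&` tidy S 0%R b).

Lemma tidy_block x v : tidy S 0%R b x -> block v -> block (x v).
Proof.
move=> [xp _] [vl vr]; rewrite /block /=.
by have [|-> ->] := fix_level (v := v) xp; [lia|].
Qed.

(** A restriction is determined by a self-map of the finite block. *)
Lemma restrictions_finite : finite_set block ->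
  finite_set [set block_restrict (aut_fun x) | x in beyond_fixer0].
Proof.
move=> finB; pose Z := fset_set block.
pose mk (f : {ffun Z -> Z}) : T -> T :=
  fun v => if insub v is Some z then val (f z) else v.
apply: (@sub_finite_set _ _ (mk @` [set: {ffun Z -> Z}])); last first.
  by apply: finite_image; exact: finite_finset.
move=> _ [x [_ xt] <-].
have xZ (z : Z) : x (val z) \in Z.
  have := valP z; rewrite !in_fset_set// !inE.
  exact: tidy_block.
exists [ffun z => [` xZ z]%fset] => //; apply/funext => v; rewrite /mk.
case: insubP => [z vZ <-|vZ].
  by rewrite ffunE /= block_restrict_in//; have := valP z; rewrite in_fset_set// inE.
by rewrite block_restrict_out//; move: vZ; rewrite in_fset_set// => /negP vZ Bv; apply: vZ; rewrite inE.
Qed.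

(** Two elements are in the same coset exactly if they have the same
    restriction, so that elements with given restrictions represent the
    cosets. *)
Lemma transversal_restrictions (M : set (T -> T)) :
  M = [set block_restrict (aut_fun x) | x in beyond_fixer0] -> finite_set block ->
  exists (J : finType) (t : J -> treeAut T), #|J| = card_set M /\
    left_transversal beyond_fixer0 (fixer c F (beyond S `|` (block `|` [set p 0%R]))) t.
Proof.
move=> ME finB; have finM : finite_set M by rewrite ME; exact: restrictions_finite.
pose J : finType := fset_set M.
have tP (j : J) : exists x, beyond_fixer0 x /\ block_restrict (aut_fun x) = val j.
  have : M (val j) by have := valP j; rewrite in_fset_set// inE.
  by rewrite {1}ME => -[x Hx <-]; exists x.
have [t tE] := choice tP; exists J, t; split; first by rewrite /card_set -cardfE.
have b0 : (0 <= (0 : int) <= b)%R by lia.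
split; [split=> [j|i j [_ tij]]|move=> x Hx].
- exact: (tE j).1.
- apply: val_inj; rewrite -(tE i).2 -(tE j).2; apply/funext => v.
  have [Bv|nB] := pselect (block v); last by rewrite !block_restrict_out.
  have /(congr1 (t i)) := tij v (or_intror (or_introl Bv)).
  by rewrite !block_restrict_in// autME autKV.
have xM : block_restrict (aut_fun x) \in fset_set M by rewrite in_fset_set// inE ME; exists x.
pose j : J := [` xM]%fset; exists j.
have [[tjH tjt] tjx] := tE j; case: Hx => xH xt.
have [hF hh] := subgroupVM (fixer_subgroup c F (beyond S)) tjH xH.
split=> // v [/hh//|[Bv|->]].
  have : block_restrict (aut_fun (t j)) v = block_restrict (aut_fun x) v by rewrite tjx.
  by rewrite !block_restrict_in// autME => <-; rewrite autK.
by rewrite autME xt.1// fixV// tjt.1.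
Qed.

Lemma sigma_ext (h h' : T -> T) v : h v = h' v ->
  (forall w, adj v w -> h w = h' w) -> sigma c h v = sigma c h' v.
Proof.
move=> hv hw; rewrite /sigma; congr insubd; apply/ffunP => i; rewrite !ffunE hv hw//.
exact: adj_nbr.
Qed.

Section InitialBlock.
Variable P0 : @subgraph d T.
Hypothesis P0_verts : forall v, verts P0 v <->
  [\/ block v, v = p 0%R | v = p (l%:Z + 1)%R].
Hypothesis P0_edges : forall u v, edges P0 (u, v) <->
  [/\ adj u v, verts P0 u & verts P0 v].
Hypothesis P0_internal : internal P0 = block_core.
Hypothesis axisE : axis g = range p.

Let P0_line i : (0 <= i <= l%:Z + 1)%R -> verts P0 (p i).
Proof.
move=> il; apply/P0_verts; have [->|/eqP i0] := eqVneq i 0%R; first by apply: Or32.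
have [->|/eqP il1] := eqVneq i (l%:Z + 1)%R; first by apply: Or33.
by apply: Or31; split; rewrite ?level_p ?height_p; lia.
Qed.

Lemma Mset_condition (a : T -> T) v (k : nat) :
  (sigma c a v \in (sigma c (g ^+ k)%g v *: (F : {set 'S_d}) :*
           (sigma c (g ^+ k)%g (a v))^-1 :&: F)%g) =
  ((sigma c (g ^+ k)%g v)^-1 * sigma c a v * sigma c (g ^+ k)%g (a v) \in F)%g
  && (sigma c a v \in F).
Proof. by rewrite inE mem_rcoset invgK mem_lcoset mulgA. Qed.

(** A power of g that carries the block to levels from [frame_end] on is large
    enough for the condition in M, uniformly in the vertex. *)
Lemma restrict_Mset x : beyond_fixer0 x -> Mset c F g P0 (block_restrict x).
Proof.
move=> [xH xt]; have xp := xt.1.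
have xE v : verts P0 v -> block_restrict x v = x v.
  have [Bv|nB] := pselect (block v); first by rewrite block_restrict_in.
  move=> /P0_verts[//|->|->]; rewrite block_restrict_out// ?level_p.
  - by rewrite xp//; lia.
  - by rewrite /block /= level_p; lia.
  - by rewrite xp//; lia.
  - by rewrite /block /= level_p; lia.
have xP0 y v : tidy S 0%R b y -> verts P0 v -> verts P0 (y v).
  move=> yt /P0_verts[Bv|->|->]; apply/P0_verts.
  - by apply: Or31; exact: tidy_block.
  - by apply: Or32; apply: yt.1; lia.
  - by apply: Or33; apply: yt.1; lia.
have xVt := subgroupV (tidy_subgroup S 0%R b) xt.
split.
- split=> [|u v Pu Pv|v nP].
  + split=> [v Pv|u v /set_mem Pu /set_mem Pv|v Pv] /=.
    * by rewrite xE//; exact: xP0.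
    * by rewrite !xE// => /aut_inj.
    * exists (x^-1%g v); first exact: xP0.
      by rewrite xE ?autKV//; exact: xP0.
  + rewrite !xE// !P0_edges aut_adj.
    by split=> -[? ? ?]; split=> //; exact: xP0.
  + by rewrite block_restrict_out// => Bv; apply: nP; apply/P0_verts/Or31.
- move=> v; rewrite axisE => -[i _ <-] Pi; rewrite xE//; apply: xp.
  move/P0_verts: Pi => [[]|/line_inj|/line_inj]; rewrite ?level_p; lia.
exists (absz b) => // k /= bk v; rewrite P0_internal => -[vl vr].
have vcore : tube S 0%R b v by split=> //; lia.
have [lx hx] := fix_level xp vcore.1.
have Pv : verts P0 v by apply/P0_verts/Or31; split=> //; lia.
have Pw w : adj v w -> verts P0 w.
  have : internal P0 v by rewrite P0_internal.
  by move=> [_ vint] /vint/P0_edges[].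
have -> : sigma c (block_restrict x) v = sigma c x v.
  by apply: sigma_ext => [|w /Pw]; exact: xE.
rewrite xE// Mset_condition.
have [xpos xneg] := (xt.2 v).1 vcore.
apply/andP; split; last first.
  have low w : level w = level v -> (level w <= l%:Z)%R || (r <= height w) by lia.
  exact: (eventually_low (low v erefl) (low _ lx)).1.
rewrite -sigmaJ; set h := (g ^+ k)%g.
have kl : (absz b)%:Z%R = b by lia.
have hb w : level w = level v -> (b <= level (h w))%R.
  by move=> wl; rewrite level_pow wl; nia.
(* the condition at v is moved to h v, where it no longer depends on large powers *)
move/(eventually_FX _ _ _ k): xpos; rewrite -/h => xpos.
have hxv : (h * x * h^-1)%g (h v) = h (x v) by rewrite !autME autK.
apply: (eventually_high (S := S) _ _).1 xpos; first by rewrite hb.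
by rewrite hxv hb.
Qed.

Hypothesis P0_subtree : subtree P0.

Section Extension.
Variable a : T -> T.
Hypothesis aM : Mset c F g P0 a.

(** The local action of the extension at u: above the core of the block it is
    that of a at the ancestor of u of height [frame_radius] - 1, the highest
    at which a prescribes one. *)
Definition ext_perm u : 'S_d := if (0 < level u <= l%:Z)%R
  then sigma c a (iter (height u - r.-1) parent u) else 1%g.

Fixpoint ext_above n v := match n with
  | 0 => a v
  | n'.+1 => nbr c (ext_above n' (parent v)) (ext_perm (parent v) (c (parent v) v))
  end.

Definition ext v := if (0 < level v <= l%:Z)%R then ext_above (height v - r) v else v.

Let a_line i : (0 <= i <= l%:Z + 1)%R -> a (p i) = p i.
Proof.
have [_ aax _] := aM; move=> il; apply: aax; last exact: P0_line.
by rewrite axisE; exists i.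
Qed.

Let core_verts v w : block_core v -> adj v w -> verts P0 w.
Proof. by rewrite -P0_internal => -[_ vint] /vint/P0_edges[]. Qed.

Let block_verts v : block v -> verts P0 v.
Proof. by move=> Bv; apply/P0_verts/Or31. Qed.

Let core_block v : block_core v -> block v.
Proof. by move=> [vl vr]; split=> //; exact: ltnW. Qed.

Let a_core v w : block_core v -> adj v w ->
  a w = nbr c (a v) (sigma c a v (c v w)) /\ adj (a v) (a w).
Proof.
move=> vcore vw; have [aaut _ _] := aM; have [_ aedge _] := aaut.
have adja : adj (a v) (a w).
  have Pv := block_verts (core_block vcore); have Pw := core_verts vcore vw.
  have e := (aedge v w Pv Pw).2 ((P0_edges v w).2 (And3 vw Pv Pw)).
  by have [] := (P0_edges (a v) (a w)).1 e.
split=> //; rewrite (sigma_subE _ _ P0_subtree aaut) ?P0_internal//.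
by rewrite (nbrK c vw) nbrK.
Qed.

Lemma ext_block v : block v -> ext v = a v.
Proof. by move=> [vl vr]; rewrite /ext vl (eqP vr). Qed.

Lemma ext_outside v : ~~ (0 < level v <= l%:Z)%R -> ext v = v /\ ext_perm v = 1%g.
Proof. by rewrite /ext /ext_perm => /negbTE->. Qed.

Lemma ext_verts v : verts P0 v -> ext v = a v.
Proof.
move=> /P0_verts[/ext_block//|->|->]; rewrite a_line; try lia.
  have [|-> //] := @ext_outside (p 0%R); by rewrite level_p; lia.
have [|-> //] := @ext_outside (p (l%:Z + 1)%R); by rewrite level_p; lia.
Qed.

Lemma ext_child v : (0 < level v <= l%:Z)%R -> r < height v ->
  ext v = nbr c (ext (parent v)) (ext_perm (parent v) (c (parent v) v)).
Proof.
move=> vl rv; rewrite /ext level_parent vl.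
have h0 : 0 < height v by lia.
have -> : height v - r = (height (parent v) - r).+1 by rewrite height_parent//; lia.
by [].
Qed.

Lemma ext_perm_parent v : (0 < level v <= l%:Z)%R -> r <= height v ->
  ext_perm v = ext_perm (parent v).
Proof.
move=> vl rv; rewrite /ext_perm level_parent vl.
have h0 : 0 < height v by lia.
have -> : height v - r.-1 = (height (parent v) - r.-1).+1 by rewrite height_parent//; lia.
by rewrite iterSr.
Qed.

Lemma ext_perm_core v : block_core v -> ext_perm v = sigma c a v.
Proof.
move=> [vl vr]; rewrite /ext_perm vl.
by have -> : height v - r.-1 = 0 by lia.
Qed.

(** The only point to check is the edge from v down to its parent w when v is
    not in the core: v and w carry the same permutation, and the colour of an
    edge does not depend on its orientation. *)
Lemma ext_nbr v (i : 'I_d) : ext (nbr c v i) = nbr c (ext v) (ext_perm v i).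
Proof.
have vw := adj_nbr c v i; have := col_nbr c v i.
move: (nbr c v i) vw => w vw <- {i}.
have [vl|vout] := boolP (0 < level v <= l%:Z)%R; last first.
  have [-> ->] := ext_outside vout; rewrite perm1 nbrK//.
  have [wl|/ext_outside[]//] := boolP (0 < level w <= l%:Z)%R.
  have [|_ wE _] := @level_adj _ _ p v w vw; first by move=> e; rewrite e wl in vout.
  have Pw : verts P0 w by rewrite wE; apply: P0_line; lia.
  by rewrite ext_verts// wE a_line//; lia.
have [vr|rv] := ltnP (height v) r.
  have vcore : block_core v by [].
  rewrite (ext_block (core_block vcore)) (ext_verts (core_verts vcore vw)).
  by rewrite ext_perm_core//; have [] := a_core vcore vw.
have h0 : 0 < height v by lia.
have [[_ wE]|[w0 vE]|[j [vE _]]|[j [vE _]]] := adjP p vw.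
- have wl : (0 < level w <= l%:Z)%R by rewrite wE level_parent.
  have wv : adj w v by rewrite adj_sym.
  have vE : ext v = nbr c (ext w) (ext_perm w (c w v)).
    have [rv'|rv'] := ltnP r (height v); first by rewrite wE; exact: ext_child.
    have wcore : block_core w by split=> //; rewrite wE height_parent//; lia.
    have vB : block v by [].
    rewrite (ext_block vB) (ext_block (core_block wcore)) ext_perm_core//.
    by have [] := a_core wcore wv.
  have adjE : adj (ext w) (ext v) by rewrite vE; exact: adj_nbr.
  (* the edge read in the other direction *)
  have cE : c (ext v) (ext w) = ext_perm v (c v w).
    rewrite -col_sym// ext_perm_parent// -wE (col_sym _ vw).
    by rewrite vE col_nbr.
  by rewrite -cE nbrK// adj_sym.
- have wl : (0 < level w <= l%:Z)%R by rewrite -(level_parent p w) -vE.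
  rewrite vE; apply: ext_child => //.
  by have [_ <-] := parentP w0; rewrite -vE.
- by rewrite vE height_p in h0.
- by rewrite vE height_p in h0.
Qed.

Lemma ext_restriction : exists2 x : treeAut T, beyond_fixer0 x & block_restrict (aut_fun x) = a.
Proof.
have [x xE sE] := aut_of_local ext_nbr.
have [[_ _ aout] aax [N _ aN]] := aM.
have x_out v : (l%:Z < level v)%R -> x v = v /\ sigma c x v = 1%g.
  by move=> lv; rewrite xE sE; apply: ext_outside; lia.
have x_line : fixes_line S 0%R b x.
  move=> i ib; rewrite xE; have [il|li] := lerP i (l%:Z + 1)%R.
    by rewrite ext_verts ?a_line//; [lia|apply: P0_line; lia].
  have [|-> //] := @ext_outside (p i); by rewrite level_p; lia.
have aF v : block_core v -> sigma c a v \in F.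
  move=> vcore; have := aN N (leqnn N) v; rewrite P0_internal => /(_ vcore).
  by rewrite Mset_condition => /andP[].
have xF v : sigma c x v \in F.
  rewrite sE /ext_perm; case: ifP => [vl|_]; last exact: group1.
  apply: aF; split; first by elim: (height v - _) => //= n; rewrite level_parent.
  have H n : n <= height v -> height (iter n parent v) = height v - n.
    elim: n => [|n IH] nv; first by rewrite subn0.
    by rewrite iterS height_parent IH; lia.
  by rewrite H; lia.
exists x; last first.
  apply/funext => v; have [Bv|nB] := pselect (block v).
    by rewrite block_restrict_in// xE ext_block.
  rewrite block_restrict_out//; have [Pv|nP] := pselect (verts P0 v); last by rewrite aout.
  by case/P0_verts: Pv => [//|->|->]; rewrite a_line//; lia.
split.
  split=> // v [/x_out[]//|->].
  by apply: x_line; lia.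
split=> // v; split=> [[vb vr]|//].
have [lx hx] := fix_level x_line vb.
have [lv|vl] := ltrP l%:Z%R (level v).
  by have [? ?] := x_out v lv; exact: good_fixed.
have vcore : block_core v by split=> //; lia.
split; last first.
  have low w : level w = level v -> (level w <= l%:Z)%R || (r <= height w) by move=> ->; lia.
  exact: (eventually_low (low v erefl) (low _ lx)).2.
exists N => k /aN /(_ v); rewrite P0_internal => /(_ vcore).
rewrite Mset_condition sigmaJ xE sE ext_perm_core// ext_block; last exact: core_block.
by case/andP.
Qed.

End Extension.

Lemma MsetE : Mset c F g P0 = [set block_restrict (aut_fun x) | x in beyond_fixer0].
Proof.
apply/seteqP; split=> [a /ext_restriction[x xH <-]|_ [x xH <-]]; first by exists x.
exact: restrict_Mset.
Qed.

End InitialBlock.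
End Block.

(** * Complete subtrees *)

Section Subtrees.
Context {d : nat} {T : regularTree d}.
Implicit Types (S : @subgraph d T) (u v w : T) (E : set T).

(** A path in the subtree between the ends of an edge would close a circuit
    unless it is that edge. *)
Lemma subtree_edges S u v : subtree S -> verts S u -> verts S v -> adj u v ->
  edges S (u, v).
Proof.
move=> [_ Sadj _ Sconn] Su Sv uv.
have [q uq lastq] := Sconn u v Su Sv; move: lastq.
have eadj x y : `[< edges S (x, y) >] -> adj x y by move=> /asboolP/Sadj[].
case/shortenP: uq => q' uq' unq' _ lastq'.
case: q' => [|y [|z q']] in uq' unq' lastq' *.
- by move: uv; rewrite -lastq' /= adj_irr.
- by move: uq'; rewrite /= andbT -lastq' => /asboolP.
have uadj : path adj u [:: y, z & q'] by apply: sub_path uq'.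
exfalso; apply: (@tree_acyclic _ T [:: u, y, z & q']) => //.
rewrite /ucycle unq' andbT.
have : path adj u (rcons [:: y, z & q'] u).
  by rewrite rcons_path uadj lastq' adj_sym.
exact: id.
Qed.

Lemma subtree_joined S u v : subtree S -> verts S u -> verts S v ->
  joined (verts S) u v.
Proof.
move=> [_ Sadj _ Sconn] Su Sv; have [q uq lastq] := Sconn u v Su Sv.
exists q; split=> //; first by apply: sub_path uq => x y /asboolP/Sadj[].
elim: q u Su uq {lastq} => [|y q IH] u Su /=; first by move=> _ x; rewrite inE => /eqP->.
move=> /andP[/asboolP/Sadj[_ _ Sy] yq] x; rewrite inE => /orP[/eqP->//|].
exact: IH.
Qed.

(** A vertex with two neighbours in a complete subtree does not have valency 1
    there. *)
Lemma complete_full S v w1 w2 w : complete_subtree S -> verts S v ->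
  verts S w1 -> verts S w2 -> w1 <> w2 -> adj v w1 -> adj v w2 -> adj v w ->
  verts S w.
Proof.
move=> [sS cS] Sv S1 S2 ne a1 a2 aw; have [/(_ w aw)//|[z [_ uz]]] := cS v Sv.
exfalso; apply: ne; rewrite -(uz w1); last exact: subtree_edges.
by apply: uz; exact: subtree_edges.
Qed.

Definition induced E : @subgraph d T :=
  Subgraph E [set e | [/\ adj e.1 e.2, E e.1 & E e.2]].

Lemma induced_subtree E o : E o -> (forall v, E v -> joined E v o) ->
  subtree (induced E).
Proof.
move=> Eo Ej; split=> [|u v []//|u v [uv Eu Ev]|u v Eu Ev].
- by exists o.
- by split; rewrite //= adj_sym.
have [q [uq lastq Eq]] := joined_trans (Ej u Eu) (joined_sym (Ej v Ev)).
exists q => //; elim: q u {Eu lastq} uq Eq => //= y q IH u /andP[uy yq] Eq.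
rewrite IH// ?andbT => [|x xq]; last by apply: Eq; rewrite inE xq orbT.
by apply/asboolP; split=> //=; apply: Eq; rewrite !inE eqxx ?orbT.
Qed.

End Subtrees.

(** * Branches off a line *)

Section Degree.
Context {d : nat} {T : regularTree d} (c : colouring T) (p : line T).
Local Notation height := (height p).
Local Notation parent := (parent p).
Local Notation level := (level p).

Lemma line_prev i : adj (p i) (p (i - 1)%R).
Proof. by rewrite adj_sym -[X in adj _ (p X)](subrK 1%R i); exact: line_adj. Qed.

Lemma line_next_prev i : p (i + 1)%R <> p (i - 1)%R.
Proof. by move=> /line_inj; lia. Qed.

(** The line shows that there are at least two colours, so some edge at v does
    not lead to the parent. *)
Lemma exists_child v : 0 < height v -> exists2 w, adj v w & height w = (height v).+1.
Proof.
move=> v0; have [vp hp] := parentP v0.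
have [i ne] : exists i : 'I_d, i != c v (parent v).
  have [e|ne] := eqVneq (c (p 0%R) (p (0 + 1)%R)) (c v (parent v)); last by eexists; exact: ne.
  exists (c (p 0%R) (p (0 - 1)%R)); rewrite -e; apply/eqP => e'.
  by apply: (@line_next_prev 0%R); exact: (col_inj (line_adj p 0%R) (line_prev 0%R) (esym e')).
exists (nbr c v i); first exact: adj_nbr.
have vw := adj_nbr c v i; have [[_ wE]|[w0 vE]|[j [vE _]]|[j [vE _]]] := adjP p vw.
- by move: ne; rewrite -wE col_nbr eqxx.
- by have [_ <-] := parentP w0; rewrite -vE.
- by rewrite vE height_p in v0.
- by rewrite vE height_p in v0.
Qed.

(** Two colours are used up by the line. *)
Lemma exists_side_branch i : 2 < d ->
  exists w, [/\ adj (p i) w, height w = 1 & level w = i].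
Proof.
move=> d3; have [k] : exists k : 'I_d, k \notin [:: c (p i) (p (i + 1)%R); c (p i) (p (i - 1)%R)].
  apply/existsP; rewrite -negb_forall; apply/negP => /forallP all2.
  have := card_size [:: c (p i) (p (i + 1)%R); c (p i) (p (i - 1)%R)].
  by rewrite (eq_card (B := 'I_d)) ?card_ord => [|k]; [rewrite /=; lia|rewrite all2].
rewrite !inE negb_or => /andP[ne1 ne2].
have vw := adj_nbr c (p i) k; exists (nbr c (p i) k); have cw := col_nbr c (p i) k.
have [[]|[w0 vE]|[j [/line_inj <- wE]]|[j [/line_inj ij wE]]] := adjP p vw.
- by rewrite height_p.
- have [_ hw] := parentP w0; split=> //; first by rewrite -hw -vE height_p.
  by rewrite -level_parent -vE level_p.
- by move: ne1; rewrite -cw wE eqxx.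
- by move: ne2; rewrite -cw wE ij addrK eqxx.
Qed.

Lemma iter_parent_height v n : n <= height v ->
  height (iter n parent v) = height v - n /\ level (iter n parent v) = level v.
Proof.
elim: n => [|n IH] nv; first by rewrite subn0.
have [hn ln] := IH (ltnW nv).
have h0 : 0 < height (iter n parent v) by rewrite hn; lia.
by rewrite iterS level_parent (height_parent h0) hn; split=> //; lia.
Qed.

Lemma branch_root v : 0 < height v ->
  let u := iter (height v).-1 parent v in
  [/\ adj (p (level v)) u, height u = 1 & level u = level v].
Proof.
move=> v0 /=; have [|hu lu] := @iter_parent_height v (height v).-1; first by lia.
have hu1 : height (iter (height v).-1 parent v) = 1 by lia.
split=> //; have [|up _] := @parentP _ _ p (iter (height v).-1 parent v); first by rewrite hu1.
by rewrite adj_sym p_level -{2}(prednK v0) iterS.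
Qed.

Lemma degree_line v : d <= 2 -> height v = 0.
Proof.
move=> d2; apply/eqP; rewrite -leqn0 leqNgt; apply/negP => v0.
have [pu hu lu] := branch_root v0; set u := iter _ _ _ in pu hu lu.
set i := level v in pu lu *.
have uniq3 : uniq [:: c (p i) (p (i + 1)%R); c (p i) (p (i - 1)%R); c (p i) u].
  have cinj := @col_inj _ _ c (p i).
  rewrite /= !inE !negb_or andbT -!andbA; apply/and3P; split; apply/eqP.
  - by move=> /(cinj _ _ (line_adj p i) (line_prev i))/line_next_prev.
  - by move=> /(cinj _ _ (line_adj p i) pu) e; rewrite -e height_p in hu.
  - by move=> /(cinj _ _ (line_prev i) pu) e; rewrite -e height_p in hu.
have := max_card (mem [:: c (p i) (p (i + 1)%R); c (p i) (p (i - 1)%R); c (p i) u]).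
by rewrite (card_uniqP uniq3) card_ord /=; lia.
Qed.

End Degree.

(** * The shape of a pando *)

Section PandoShape.
Context {d : nat} {T : regularTree d} (c : colouring T) (p : line T).
Variables (P : @subgraph d T) (b : int).
Hypothesis P_complete : complete_subtree P.
Hypothesis b_ge2 : (2%:Z <= b)%R.
Hypothesis P_line : forall i, verts P (p i) <-> (0 <= i <= b)%R.
Implicit Types (u v w : T) (i j : int).
Local Notation height := (height p).
Local Notation parent := (parent p).
Local Notation level := (level p).

Let P_subtree : subtree P. Proof. by case: P_complete. Qed.

(** A path in P from v to the line cannot leave the descendants of v except
    through the parent of v. *)
Lemma P_parent v : verts P v -> 0 < height v -> verts P (parent v).
Proof.
move=> Pv v0.
have P0 : verts P (p 0%R) by apply/P_line; lia.
suff [[n]|//] : (exists n, iter n parent (p 0%R) = v) \/ verts P (parent v).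
  have -> : iter n parent (p 0%R) = p 0%R by elim: n => //= n ->; rewrite parent_p.
  by move=> vE; rewrite -vE height_p in v0.
apply: (joined_ind _ (subtree_joined P_subtree Pv P0)
  (R := [set y | (exists n, iter n parent y = v) \/ verts P (parent v)])); last first.
  by left; exists 0.
move=> x y xy Px Py [[n xv]|]; last by right.
have line_out i : iter n parent (p i) = v -> False.
  have -> : iter n parent (p i) = p i by elim: {xv} n => //= n ->; rewrite parent_p.
  by move=> vE; rewrite -vE height_p in v0.
have [[_ yE]|[_ xE]|[j [xE _]]|[j [xE _]]] := adjP p xy.
- case: n xv {line_out} => [|n] xv; first by right; rewrite -xv -yE.
  by left; exists n; rewrite yE -iterSr.
- by left; exists n.+1; rewrite iterSr -xE.
- by rewrite xE in xv; case: (line_out _ xv).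
- by rewrite xE in xv; case: (line_out _ xv).
Qed.

Lemma P_iter_parent v n : verts P v -> n <= height v -> verts P (iter n parent v).
Proof.
move=> Pv; elim: n => //= n IH nv; apply: P_parent; first exact/IH/ltnW.
by have [->] := iter_parent_height (ltnW nv); rewrite subn_gt0.
Qed.

Lemma P_level v : verts P v -> (0 <= level v <= b)%R.
Proof. by move=> Pv; apply/P_line; rewrite p_level; exact: P_iter_parent. Qed.

(** If v were off the line at an end of the segment in P, that end would have
    two neighbours in P, and so by completeness P would contain the next
    vertex of the line. *)
Lemma P_level_strict v : verts P v -> 0 < height v -> (0 < level v < b)%R.
Proof.
move=> Pv v0; have vl := P_level Pv.
have [pu hu _] := branch_root v0.
have Pu : verts P (iter (height v).-1 parent v) by apply: P_iter_parent; rewrite ?leq_pred.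
have une i : p i <> iter (height v).-1 parent v by move=> e; rewrite -e height_p in hu.
have Pl := (P_line (level v)).2 vl.
rewrite !lt_neqAle; case/andP: (vl) => -> ->; rewrite !andbT; apply/andP; split; apply/eqP => e.
  have : verts P (p (-1)%R); last by move/P_line; lia.
  rewrite -e in pu Pl.
  apply: (complete_full P_complete Pl _ Pu (@une 1%R) _ pu); [by apply/P_line; lia| |].
    by have := line_adj p 0%R; rewrite add0r.
  by have := line_prev p 0%R; rewrite sub0r.
have : verts P (p (b + 1)%R); last by move/P_line; lia.
rewrite e in pu Pl.
apply: (complete_full P_complete Pl _ Pu (@une (b - 1)%R) _ pu); [by apply/P_line; lia|exact: line_prev|exact: line_adj].
Qed.

Lemma P_ends v : verts P v ->
  [\/ (0 < level v < b)%R, v = p 0%R | v = p b].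
Proof.
move=> Pv; have [v0|v0] := posnP (height v); last by apply/Or31/P_level_strict.
have vl := P_level Pv; have vE := height0_p v0.
have [e|/eqP ne] := eqVneq (level v) 0%R; first by apply: Or32; rewrite vE e.
have [e|/eqP ne'] := eqVneq (level v) b; first by apply: Or33; rewrite vE e.
by apply: Or31; lia.
Qed.

Lemma P_line_internal i : (0 < i < b)%R -> internal P (p i).
Proof.
move=> ib; have Pi : verts P (p i) by apply/P_line; lia.
split=> // w vw; apply: subtree_edges => //.
apply: (complete_full P_complete Pi _ _ (@line_next_prev _ _ p i)) vw.
- by apply/P_line; lia.
- by apply/P_line; lia.
- exact: line_adj.
- exact: line_prev.
Qed.

Lemma internal_level v : internal P v -> (0 < level v < b)%R.
Proof.
move=> [Pv vint]; have vP w : adj v w -> verts P w.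
  by case: P_subtree => _ Padj _ _ /vint/Padj[].
case: (P_ends Pv) => // e.
  have /P_line : verts P (p (0 - 1)%R) by apply: vP; rewrite e; exact: line_prev.
  by lia.
have /P_line : verts P (p (b + 1)%R) by apply: vP; rewrite e; exact: line_adj.
by lia.
Qed.

Hypothesis P_finite : finite_set (verts P).
Hypothesis P_ball : forall v, internal P (p (level v)) ->
  (exists2 u, verts P u & height u = height v) -> verts P v.

(** The heights occurring in P are closed downwards under passing to parents,
    so P contains all the vertices up to its maximal height at the levels of
    its internal vertices on the axis. If the degree is 2 all heights vanish,
    and the bound may be raised to 1. *)
Lemma P_shape : exists r, 0 < r /\ forall v, verts P v <->
  [\/ (0 < level v < b)%R /\ height v <= r, v = p 0%R | v = p b].
Proof.
pose Q n := `[< exists2 u, verts P u & height u = n >].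
have Q0 : exists n, Q n.
  by exists 0; apply/asboolP; exists (p 0%R); [apply/P_line; lia|rewrite height_p].
have Qbound n : Q n -> n <= \max_(v <- fset_set (verts P)) height v.
  move=> /asboolP[u Pu <-]; apply: (@leq_bigmax_seq _ _ xpredT (fun v => height v) u) => //.
  by rewrite in_fset_set// inE.
case: (ex_maxnP Q0 Qbound) => m /asboolP[u Pu hu] max.
have shape v : verts P v <-> [\/ (0 < level v < b)%R /\ height v <= m, v = p 0%R | v = p b].
  split=> [Pv|].
    have [vl|->|->] := P_ends Pv; [apply: Or31|exact: Or32|exact: Or33].
    by split=> //; apply: max; apply/asboolP; exists v.
  case=> [[vl vm]|->|->]; try by (apply/P_line; lia).
  apply: P_ball; first exact: P_line_internal.
  have hmu : m - height v <= height u by rewrite hu leq_subr.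
  exists (iter (m - height v) parent u); first exact: P_iter_parent.
  by have [-> _] := iter_parent_height hmu; lia.
have [d2|d3] := leqP d 2.
  exists 1; split=> // v; rewrite shape.
  by rewrite !(degree_line c p v d2).
exists m; split=> //.
have [w [pw hw lw]] := exists_side_branch c p 1%R d3.
have [P1 P1int] : internal P (p 1%R) by apply: P_line_internal; lia.
apply: max; apply/asboolP; exists w => //.
by case: P_subtree => _ Padj _ _; have [] := Padj _ _ (P1int w pw).
Qed.

End PandoShape.

Lemma line_leaves d (T : regularTree d) (f : nat -> T) (A : set T) :
  injective f -> finite_set A -> exists n, ~ A (f n).
Proof.
move=> finj finA; apply: contrapT => no; apply: infinite_nat.
have -> : [set: nat] = f @^-1` A.
  by apply/seteqP; split=> // n _; apply: contrapT => nA; apply: no; exists n.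
by apply: finite_preimage => // n m _ _; exact: finj.
Qed.

(** The pando meets the axis in a segment, as a subtree contains the geodesics
    between its vertices; the frame is numbered from its first vertex. A
    singularity of height [frame_radius] would be internal to P and so have a
    child in P. *)
Lemma pando_frame d (T : regularTree d) (c : colouring T) (F : {group 'S_d})
    (g : treeAut T) (P : subgraph) : pando c F g P ->
  exists S : tubeFrame c F g, let p := frame_line S in
    axis g = range p /\ forall v, verts P v <->
      [\/ (0 < level p v < frame_end S)%R /\ height p v <= frame_radius S,
          v = p 0%R | v = p (frame_end S)].
Proof.
move=> [Pc Pfin Psing [v [[p' [l [p'inj p'adj [l0 gp'] [j _ vE]]]] Pv gvint]] Pball].
subst v; have Ps : subtree P by case: Pc.
pose q := Line p'inj p'adj.
have [Pgj gjint] := gvint; rewrite gp' in Pgj gjint.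
have edge_in v w : edges P (v, w) -> verts P w by case: Ps => _ Padj _ _ /Padj[].
have Pe : verts P (q (j + l%:Z + 1)%R) by apply: edge_in (gjint _ (p'adj _)).
have convex i k i' : (i <= k <= i')%R -> verts P (q i) -> verts P (q i') -> verts P (q k).
  move=> iki' Pi Pi'; have [->//|/eqP ik] := eqVneq k i.
  suff [|//] : (level q (q i') < k)%R \/ verts P (q k) by rewrite level_p; lia.
  apply: (joined_ind _ (subtree_joined Ps Pi Pi')
    (R := [set y | (level q y < k)%R \/ verts P (q k)])); last first.
    by left; rewrite level_p; lia.
  move=> x y xy Px Py [xk|]; last by right.
  have [yk|ky] := ltrP (level q y) k; first by left.
  have xk' : (level q x <= k - 1)%R by lia.
  have ky' : (k - 1 < level q y)%R by lia.
  by right; have [_] := level_cross xy xk' ky'; rewrite subrK => <-.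
have [a [Pa Pa1 aj]] : exists a, [/\ verts P (q a), ~ verts P (q (a - 1)%R) & (a <= j)%R].
  have inj : injective (fun n : nat => q (j - n%:Z)%R) by move=> n m /p'inj; lia.
  have [n0 nP] := line_leaves inj Pfin.
  have ex : exists n, `[< ~ verts P (q (j - n%:Z)%R) >] by exists n0; apply/asboolP.
  case: (ex_minnP ex) => -[|n] /asboolP nPn min.
    by case: nPn; rewrite subr0.
  exists (j - n%:Z)%R; split; last by lia.
    (* n precedes the first step at which the axis leaves P *)
    apply: contrapT => nP'; have := min n; rewrite ltnn => H.
    by have := H (asboolT nP').
  by rewrite (_ : j - n%:Z - 1 = j - n.+1%:Z)%R; [|lia].
have [e [Pe' Pe1 ej]] : exists e,
    [/\ verts P (q e), ~ verts P (q (e + 1)%R) & (j + l%:Z + 1 <= e)%R].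
  have inj : injective (fun n : nat => q (j + l%:Z + 1 + n%:Z)%R) by move=> n m /p'inj; lia.
  have [n0 nP] := line_leaves inj Pfin.
  have ex : exists n, `[< ~ verts P (q (j + l%:Z + 1 + n%:Z)%R) >].
    by exists n0; apply/asboolP.
  case: (ex_minnP ex) => -[|n] /asboolP nPn min.
    by case: nPn; rewrite addr0.
  exists (j + l%:Z + 1 + n%:Z)%R; split; last by lia.
    (* n precedes the first step at which the axis leaves P *)
    apply: contrapT => nP'; have := min n; rewrite ltnn => H.
    by have := H (asboolT nP').
  by rewrite (_ : j + l%:Z + 1 + n%:Z + 1 = j + l%:Z + 1 + n.+1%:Z)%R; [|lia].
have pinj : injective (fun i => q (i + a)%R) by move=> i k /p'inj; lia.
have padj i : adj (q (i + a)%R) (q (i + 1 + a)%R).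
  by rewrite (_ : i + 1 + a = i + a + 1)%R; [exact: p'adj|lia].
pose p := Line pinj padj; pose b := (e - a)%R.
have P_line i : verts P (p i) <-> (0 <= i <= b)%R.
  split=> [Pi|ib]; last by apply: (convex a _ e) => //; lia.
  apply/andP; split; rewrite leNgt; apply/negP => lt.
    by apply: Pa1; apply: (convex (i + a)%R _ a) => //; lia.
  by apply: Pe1; apply: (convex e _ (i + a)%R) => //; lia.
have gp i : g (p i) = p (i + l%:Z)%R.
  by rewrite /= gp'; congr p'; lia.
have lb : (l%:Z < b)%R by lia.
have b2 : (2%:Z <= b)%R by lia.
have ag : axis g = range p := axisE l0 gp.
have ball v : internal P (p (level p v)) ->
    (exists2 u, verts P u & height p u = height p v) -> verts P v.
  move=> vint [u Pu huv]; apply: Pball; first by rewrite (axis_projE v ag).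
  by exists u => //; rewrite !(axis_projE _ ag) !dist_axis.
have [r [r0 shape]] := P_shape c Pc b2 P_line Pfin ball.
have sing : singularities c F g `<=` [set v | (0 < level p v < b)%R /\ height p v < r].
  move=> v /Psing vint; have vb := internal_level Pc b2 P_line vint.
  have [Pv' vall] := vint.
  have [[_ vr]|e'|e'] := (shape v).1 Pv'; try by move: vb; rewrite e' level_p; lia.
  split=> //; rewrite ltn_neqAle vr andbT; apply/eqP => hv.
  have v0 : 0 < height p v by rewrite hv.
  have [w vw hw] := exists_child c v0.
  have := (shape w).1 (edge_in _ _ (vall w vw)).
  case=> [[_ wr]|wE|wE]; first by rewrite hw hv ltnn in wr.
    by rewrite wE height_p in hw.
  by rewrite wE height_p in hw.
by exists (@TubeFrame _ _ _ _ _ p l b r l0 gp lb r0 sing).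
Qed.

(** * The shape of the initial segment *)

Section InitialSegment.
Context {d : nat} {T : regularTree d} (c : colouring T) (F : {group 'S_d}).
Context {g : treeAut T} (S : tubeFrame c F g).
Variables (P P0 : @subgraph d T).
Implicit Types (u v w : T) (i j k : int).
Local Notation p := (frame_line S).
Local Notation l := (frame_shift S).
Local Notation b := (frame_end S).
Local Notation r := (frame_radius S).
Local Notation height := (height p).
Local Notation parent := (parent p).
Local Notation level := (level p).
Hypothesis P_subtree : subtree P.
Hypothesis P_verts : forall v, verts P v <->
  [\/ (0 < level v < b)%R /\ height v <= r, v = p 0%R | v = p b].

Let l_gt0 : 0 < l. Proof. exact: frame_shift_gt0. Qed.
Let gp i : g (p i) = p (i + l%:Z)%R. Proof. exact: frame_translate. Qed.
Let lb : (l%:Z < b)%R. Proof. exact: frame_shift_lt. Qed.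
Let r_gt0 : 0 < r. Proof. exact: frame_radius_gt0. Qed.

Local Notation gP := (aut_image g P).

Lemma image_verts v : verts gP v <->
  [\/ (l%:Z < level v < b + l%:Z)%R /\ height v <= r, v = p l%:Z%R | v = p (b + l%:Z)%R].
Proof.
have gl w := level_translate l_gt0 gp w; have gh w := height_translate gp w.
split=> [[w /P_verts Pw <-]|].
  case: Pw => [[wl wr]|->|->].
  - by apply: Or31; rewrite gl gh; split=> //; lia.
  - by apply: Or32; rewrite gp add0r.
  - by apply: Or33; rewrite gp.
move=> H; exists (g^-1%g v); last by rewrite autKV.
apply/P_verts; case: H => [[vl vr]|->|->].
- apply: Or31; rewrite (level_translateV l_gt0 gp) (height_translateV gp).
  by split=> //; lia.
- by apply: Or32; rewrite -[l%:Z%R]add0r -gp autK.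
- by apply: Or33; rewrite -gp autK.
Qed.

Lemma image_edges u v : adj u v -> verts gP u -> verts gP v -> edges gP (u, v).
Proof.
move=> uv [u' Pu' uE] [v' Pv' vE]; exists (u', v'); last by rewrite /= uE vE.
by apply: subtree_edges => //; rewrite -(aut_adj g) uE vE.
Qed.

Lemma block_P v : block S v -> verts P v.
Proof. by move=> [vl vr]; apply/P_verts/Or31; split=> //; lia. Qed.

(** A vertex of P outside its image has level at most [frame_shift], so it is
    in the block or is the first end. *)
Lemma verts_union : verts P `|` verts gP = verts gP `|` (block S `|` [set p 0%R]).
Proof.
apply/seteqP; split=> v /=; last first.
  by case=> [Pv|[Bv|->]]; [right|left; exact: block_P|left; apply/P_verts/Or32].
case=> [/P_verts Pv|]; last by left.
case: Pv => [[vl vr]|->|->]; last 2 first.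
- by right; right.
- by left; apply/image_verts/Or31; rewrite level_p height_p; split=> //; lia.
have [vl'|lv] := lerP (level v) l%:Z%R.
  by right; left; split=> //; lia.
by left; apply/image_verts/Or31; split=> //; lia.
Qed.

(** The vertex set of the initial segment when the degree is at least 3. *)
Definition initial_verts : set T := [set v |
  [\/ block S v, v = p 0%R | v = p (l%:Z + 1)%R]].

Lemma initial_line i : (0 <= i <= l%:Z + 1)%R -> initial_verts (p i).
Proof.
move=> il; have [->|/eqP i0] := eqVneq i 0%R; first by apply: Or32.
have [->|/eqP il1] := eqVneq i (l%:Z + 1)%R; first by apply: Or33.
by apply: Or31; split; rewrite ?level_p ?height_p; lia.
Qed.

Lemma initial_joined v : initial_verts v -> joined initial_verts v (p 0%R).
Proof.
have lineJ i : (0 <= i <= l%:Z + 1)%R -> joined initial_verts (p i) (p 0%R).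
  move=> il; apply: joined_sym.
  rewrite (_ : i = 0 + (absz i)%:Z)%R; last by lia.
  by apply: axis_joined => k ?; apply: initial_line; lia.
case=> [Bv|->|->]; try by (apply: lineJ; lia).
have [n] := ubnP (height v); elim: n v Bv => // n IH v [vl vr] lt.
have [v0|v0] := posnP (height v).
  by rewrite (height0_p v0); apply: lineJ; lia.
have [vp hp] := parentP v0.
have Bp : block S (parent v) by split; [rewrite level_parent|rewrite height_parent//; lia].
apply: joined_trans (IH _ Bp _); last by rewrite height_parent//; lia.
by apply: joined_step => //; apply: Or31.
Qed.

Lemma core_initial v w : block_core S v -> adj v w -> initial_verts w.
Proof.
move=> [vl vr] vw; have [e|/eqP ne] := eqVneq (level v) (level w).
  by apply: Or31; rewrite /block /= -e; split=> //; have := height_adj p (_ : adj w v); rewrite adj_sym => /(_ vw); lia.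
by have [|_ wE wl] := @level_adj _ _ p v w vw => //; rewrite wE; apply: initial_line; lia.
Qed.

Lemma end_neighbour i w : adj (p i) w -> initial_verts w -> ~~ (0 < i <= l%:Z)%R ->
  level w <> i.
Proof.
move=> iw Qw iout wi; case: Qw => [[wl _]|e|e].
- by rewrite -wi wl in iout.
- by move: wi iw; rewrite e level_p => ->; rewrite adj_irr.
- by move: wi iw; rewrite e level_p => ->; rewrite adj_irr.
Qed.

Lemma initial_complete : complete_subtree (induced initial_verts).
Proof.
split; first by apply: (@induced_subtree _ _ _ (p 0%R)); [exact: Or32|exact: initial_joined].
move=> v Qv; have [vcore|ncore] := pselect (block_core S v).
  by left=> w; exact: core_initial.
have alone w0 : adj v w0 -> initial_verts w0 ->
    (forall w, adj v w -> initial_verts w -> w = w0) ->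
    exists! w, edges (induced initial_verts) (v, w).
  move=> vw0 Qw0 uw; exists w0; split; first by split.
  by move=> w [/= vw _ Qw]; rewrite -(uw w).
right; case: (Qv) => [[vl vr]|vE|vE].
- have hv : height v = r.
    by apply/eqP; rewrite eqn_leq vr leqNgt; apply/negP => lt; apply: ncore.
  have v0 : 0 < height v by rewrite hv.
  have [vp hp] := parentP v0.
  apply: (alone (parent v)) => //.
    by apply: Or31; split; [rewrite level_parent|lia].
  move=> w vw Qw; apply: (parent_uniq vw) => //; rewrite hv.
  by case: Qw => [[]//|->|->]; rewrite height_p.
- have vw0 := line_adj p 0%R; rewrite add0r in vw0.
  apply: (alone (p 1%R)); rewrite ?vE//; first by apply: initial_line; lia.
  move=> w vw Qw; have ne := @end_neighbour 0%R w vw Qw ltac:(lia).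
  have [|_ wE wl] := @level_adj _ _ p (p 0%R) w vw; first by rewrite level_p; exact: nesym.
  rewrite wE; congr (p _); rewrite level_p in wl; case: wl => [|wl]; first by lia.
  have wm : level w = (-1)%R by lia.
  by case: Qw => [[]|e|e]; move: wm; rewrite ?e ?level_p; lia.
- have vw0 := line_prev p (l%:Z + 1)%R; rewrite addrK in vw0.
  apply: (alone (p l%:Z%R)); rewrite ?vE//; first by apply: initial_line; lia.
  move=> w vw Qw; have ne := @end_neighbour (l%:Z + 1)%R w vw Qw ltac:(lia).
  have [|_ wE wl] := @level_adj _ _ p (p (l%:Z + 1)%R) w vw; first by rewrite level_p; exact: nesym.
  rewrite wE; congr (p _); rewrite level_p in wl; case: wl => [wl|]; last by lia.
  by case: Qw => [[]|e|e]; move: wl; rewrite ?e ?level_p; lia.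
Qed.

(** The vertices of P that are not in the initial segment lie at levels beyond
    [frame_shift], where P is contained in its image. *)
Lemma P_initial u v : verts P u -> ~ initial_verts u -> adj u v -> verts P v ->
  verts gP u /\ verts gP v.
Proof.
move=> Pu nu uv Pv.
have out w : verts P w -> (l%:Z < level w)%R -> verts gP w.
  move=> /P_verts[[wl wr]|->|->]; rewrite ?level_p => lw; apply/image_verts/Or31.
  - by split=> //; lia.
  - lia.
  - by rewrite level_p height_p; split=> //; lia.
have lu : (l%:Z < level u)%R.
  rewrite ltNge; apply/negP => ul; apply: nu; move/P_verts: Pu => [[ul' ur]|->|ub].
  - by apply: Or31; split=> //; lia.
  - exact: Or32.
  - by move: ul; rewrite ub level_p; lia.
split; first exact: out.
apply: out => //; rewrite ltNge; apply/negP => vl.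
by apply: nu; apply: Or33; rewrite adj_sym in uv; have [] := level_cross uv vl lu.
Qed.

Hypothesis P0_initial : initial_segment g P P0.
Hypothesis d_gt2 : 2 < d.

Let P0_complete : complete_subtree P0. Proof. by case: P0_initial. Qed.

Let P0_subtree : subtree P0. Proof. by case: P0_complete. Qed.

Lemma P0_sub_initial : verts P0 `<=` initial_verts.
Proof.
have [_ _ /(_ _ initial_complete)] := P0_initial.
suff H : subgraph_le (Subgraph (verts P `\` verts gP) (edges P `\` edges gP))
    (induced initial_verts) by move=> /(_ H)[].
have [_ Padj Psym _] := P_subtree.
split=> [v [Pv ngP]|[u v] [Puv ngP]].
  have : (verts gP `|` (block S `|` [set p 0%R])) v by rewrite -verts_union; left.
  by case=> [//|[Bv|->]]; [exact: Or31|exact: Or32].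
have [uv Pu Pv] := Padj _ _ Puv.
split=> //=; apply: contrapT => nQ; apply: ngP; apply: image_edges => //.
- by have [] := P_initial Pu nQ uv Pv.
- by have [] := P_initial Pu nQ uv Pv.
- by rewrite adj_sym in uv; have [] := P_initial Pv nQ uv Pu.
- by rewrite adj_sym in uv; have [] := P_initial Pv nQ uv Pu.
Qed.

(** The vertex at level [frame_shift] on the axis is in gP, but the edge of P
    leading to it is not. That vertex then has two neighbours in P0, one of
    them off the axis, and completeness adds the last vertex. With degree 2
    the last step fails. *)
Lemma initial_sub_P0 : initial_verts `<=` verts P0.
Proof.
have [_ [Dv De] _] := P0_initial.
have Pl0 v : (level v <= l%:Z)%R -> v <> p l%:Z%R -> verts P v -> verts P0 v.
  move=> vl ne Pv; apply: Dv; split=> // /image_verts[[]|//|e]; first by lia.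
  by move: vl; rewrite e level_p; lia.
have Pp i : (0 <= i <= b)%R -> verts P (p i).
  move=> ib; apply/P_verts; have [->|/eqP i0] := eqVneq i 0%R; first exact: Or32.
  have [->|/eqP ib'] := eqVneq i b; first exact: Or33.
  by apply: Or31; rewrite level_p height_p; split=> //; lia.
have edge : adj (p (l%:Z - 1)%R) (p l%:Z%R) by rewrite adj_sym; exact: line_prev.
have P0l1 : verts P0 (p (l%:Z - 1)%R).
  apply: Pl0; [by rewrite level_p; lia|by move=> /line_inj; lia|by apply: Pp; lia].
have P0l : verts P0 (p l%:Z%R).
  suff /De : (edges P `\` edges gP) (p (l%:Z - 1)%R, p l%:Z%R).
    by case: P0_subtree => _ P0adj _ _ /P0adj[].
  split; first by apply: subtree_edges => //; apply: Pp; lia.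
  move=> [[u v] Puv [uE vE]].
  have /image_verts : verts gP (p (l%:Z - 1)%R).
    by exists u => //; case: P_subtree => _ Padj _ _; have [] := Padj _ _ Puv.
  by rewrite level_p => -[[]|/line_inj|/line_inj]; lia.
move=> v [Bv|->|->].
- have [->//|/eqP ne] := eqVneq v (p l%:Z%R).
  by apply: Pl0 => //; [case: Bv => -[]; lia|exact: block_P].
- by apply: Pl0; [rewrite level_p; lia|move=> /line_inj; lia|apply: Pp; lia].
have [w [lw hw ll]] := exists_side_branch c p l%:Z%R d_gt2.
have P0w : verts P0 w.
  apply: Pl0; [by rewrite ll|by move=> e; rewrite e height_p in hw|].
  by apply: block_P; split; [rewrite ll; lia|rewrite hw].
apply: (complete_full P0_complete P0l P0l1 P0w _ _ lw (line_adj p _)).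
  by move=> e; rewrite -e height_p in hw.
by rewrite adj_sym.
Qed.

Lemma P0_vertsE v : verts P0 v <-> initial_verts v.
Proof. by split; [exact: P0_sub_initial|exact: initial_sub_P0]. Qed.

Lemma P0_edgesE u v : edges P0 (u, v) <-> [/\ adj u v, verts P0 u & verts P0 v].
Proof.
split; first by case: P0_subtree => _ P0adj _ _; exact: P0adj.
by move=> [? ? ?]; apply: subtree_edges.
Qed.

Lemma P0_internalE : internal P0 = block_core S.
Proof.
apply/seteqP; split=> v; last first.
  move=> vcore; have [vl vr] := vcore.
  have P0v : verts P0 v by apply/P0_vertsE/Or31; split=> //; exact: ltnW.
  split=> // w vw; apply/P0_edgesE; split=> //; apply/P0_vertsE.
  exact: core_initial vw.
move=> [/P0_vertsE Qv vint].
have Qw w : adj v w -> initial_verts w by move=> /vint/P0_edgesE[_ _ /P0_vertsE].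
case: (Qv) => [[vl vr]|vE|vE].
- split=> //; rewrite ltn_neqAle vr andbT; apply/eqP => hv.
  have v0 : 0 < height v by rewrite hv.
  have [w vw hw] := exists_child c v0.
  case: (Qw w vw) => [[_]|e|e]; first by rewrite hw hv ltnn.
    by rewrite e height_p in hw.
  by rewrite e height_p in hw.
- have : initial_verts (p (0 - 1)%R) by apply: Qw; rewrite vE; exact: line_prev.
  by case=> [[]|/line_inj|/line_inj]; rewrite ?level_p; lia.
- have : initial_verts (p (l%:Z + 1 + 1)%R) by apply: Qw; rewrite vE; exact: line_adj.
  by case=> [[]|/line_inj|/line_inj]; rewrite ?level_p; lia.
Qed.

End InitialSegment.

(** * The formula for the scale *)

Lemma fixer_block_tidy (d : nat) (T : regularTree d) (c : colouring T)
    (F : {group 'S_d}) (g : treeAut T) (S : tubeFrame c F g) :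
  fixer c F (beyond S `|` (block S `|` [set frame_line S 0%R])) `<=`
  beyond_fixer S `&` tidy S 0%R (frame_end S).
Proof.
move=> x xfix; have [xF xv] := xfix.
have lb := frame_shift_lt S; have l0 := frame_shift_gt0 S.
have r0 := frame_radius_gt0 S.
have xH : beyond_fixer S x by apply: fixerS xfix => v ?; left.
have xQ v : initial_verts S v -> x v = v.
  case=> [Bv|->|->]; apply: xv; [by right; left|by right; right|left].
  by left; rewrite level_p; lia.
split=> //; split=> [i ib|v]; last first.
  split=> [[vb vr]|_]; last exact: xF.
  have [lv|vl] := ltrP (frame_shift S)%:Z%R (level (frame_line S) v).
    by have [? ?] := beyond_fixed xH lv; exact: good_fixed.
  have vcore : block_core S v by split=> //; lia.
  have xvv : x v = v by apply: xQ; apply: Or31; split; [lia|exact: ltnW].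
  by apply: good_fixed => //; apply: sigma_fixed => // w /(core_initial vcore)/xQ.
have [il|li] := lerP i (frame_shift S)%:Z%R.
  by apply: xQ; apply: initial_line; lia.
by apply: xH.2; left; rewrite level_p.
Qed.

(** With degree 2 the tree is the axis, and both sets consist of the identity. *)
Lemma Mset_degree_le2 (d : nat) (T : regularTree d) (c : colouring T)
    (F : {group 'S_d}) (g : treeAut T) (S : tubeFrame c F g) (P0 : subgraph) :
  d <= 2 -> axis g = range (frame_line S) ->
  Mset c F g P0 = [set block_restrict S (aut_fun x)
                    | x in beyond_fixer S `&` tidy S 0%R (frame_end S)].
Proof.
move=> d2 ag; have vE v := height0_p (degree_line c (frame_line S) v d2).
have lb := frame_shift_lt S.
have rE x : (beyond_fixer S `&` tidy S 0%R (frame_end S)) x -> block_restrict S (aut_fun x) = id.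
  move=> [_ [xp _]]; apply/funext => v.
  have [Bv|nB] := pselect (block S v); last by rewrite block_restrict_out.
  rewrite block_restrict_in// [v in LHS]vE xp; first by rewrite -vE.
  by have [] := Bv; lia.
have one : (beyond_fixer S `&` tidy S 0%R (frame_end S)) 1%g.
  split; first exact: fixer1.
  exact: subgroup1 (tidy_subgroup S 0%R (frame_end S)).
apply/seteqP; split=> [a [[_ _ aout] aax _]|_ [x xH <-]].
  exists 1%g => //; rewrite rE//; apply/funext => v; apply/esym.
  have [Pv|/aout//] := pselect (verts P0 v).
  by apply: aax => //; rewrite ag; exists (level (frame_line S) v).
rewrite rE//; split=> [|//|].
  by split=> //; split=> // v Pv; exists v.
exists 0 => // k _ v _; rewrite Mset_condition.
have -> : sigma c (id : T -> T) v = 1%g by exact: (sigma1 c v).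
by rewrite mulg1 mulVg group1.
Qed.

Local Open Scope ring_scope.

Theorem proposition3p16 (d : nat) (T : regularTree d) (c : colouring T)
    (F F' : {group 'S_d}) (g : GFF c F F') (P P0 : @subgraph d T) :
  F \subset F' ->
  hyperbolic g ->
  pando c F g P ->
  initial_segment g P P0 ->
  (scale g)%:R =
    (group_index (fixer c F (verts (aut_image g P)))
           (fixer c F (verts P `|` verts (aut_image g P))))%:R
    / (card_set (Mset c F g P0))%:R :> rat.
Proof.
move=> sFF' _ pP iP; have [S [ag P_verts]] := pando_frame pP.
have [P_complete P_finite _ _ _] := pP; have P_subtree := P_complete.1.
have lb := frame_shift_lt S; have l0 := frame_shift_gt0 S.
have block_fin : finite_set (block S).
  by apply: sub_finite_set P_finite => v; exact: block_P.
have tube_fin : finite_set (tube S 0%R (frame_end S)).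
  apply: sub_finite_set P_finite => v [vl vr]; apply/P_verts/Or31.
  by split=> //; exact: ltnW.
have [I [t [tP ->]]] := scale_tidy sFF' tube_fin.
have ME : Mset c F g P0 = [set block_restrict S (aut_fun x)
    | x in beyond_fixer S `&` tidy S 0%R (frame_end S)].
  have [d2|d3] := leqP d 2; first exact: Mset_degree_le2.
  apply: MsetE ag _.
  - by move=> v; exact: (P0_vertsE P_subtree P_verts iP d3).
  - exact: (P0_edgesE iP).
  - exact: (P0_internalE P_subtree P_verts iP d3).
  - by case: iP => -[].
have [J [u [<- uP]]] := transversal_restrictions ME block_fin.
rewrite (verts_union P_verts).
have sH := fixer_subgroup c F (beyond S).
have sV := tidy_subgroup S 0%R (frame_end S).
have tower : left_transversal (beyond_fixer S)
    (fixer c F (beyond S `|` (block S `|` [set frame_line S 0%R])))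
    (fun ij : I * J => (t ij.1 * u ij.2)%g).
  apply: transversalM tP uP => //; first exact: subgroupI.
  exact: fixer_block_tidy.
have ends : verts (aut_image g P) `<=` beyond S.
  move=> v /(image_verts P_verts)[[vl _]|->|->]; [left; lia|by right|left].
  by rewrite level_p; lia.
have := transversal_fixer ends _ _ _ tower.
rewrite (image_verts P_verts) => /(_ (Or32 _ _ erefl)).
rewrite (image_verts P_verts) => index.
rewrite (index_transversal _ (index _ _)); first last.
- by move=> v [[]|->]; rewrite ?level_p; lia.
- by apply: Or31; rewrite level_p height_p; split=> //; lia.
- exact: fixer_subgroup.
have J0 : (0 < #|J|)%N.
  have [j _] := uP.2 1%g (conj (fixer1 _ _ _) (subgroup1 sV)).
  by apply/card_gt0P; exists j.
by rewrite card_prod natrM mulfK// pnatr_eq0 -lt0n.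
Qed.
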